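(* Let $m\ge 1$ and let $f:\mathbb{R}^2\to\mathbb{R}^m_1$ be a smooth function such that $M=\operatorname{graph} f=\{(x,f(x)):x\in\mathbb{R}^2\}$ is a spacelike stationary graph in $\mathbb{R}^{2+m}_1$. If the orthogonal projection $\mathcal{P}_0$ of $M$ onto the coordinate plane $\mathbb{R}^2$ is area-increasing (i.e. $W\le 1$ everywhere), then either $f$ is affine linear, or $f=h\,\mathbf{y}_0+\mathbf{y}_1$ with $h$ a nonlinear (i.e. not affine linear) harmonic function on $\mathbb{R}^2$, $\mathbf{y}_0$ a nonzero lightlike vector in $\mathbb{R}^m_1$ and $\mathbf{y}_1\in\mathbb{R}^m_1$ a constant vector. Moreover, if $\mathcal{P}_0$ is strictly area-increasing (i.e. $W<1$ everywhere), then $f$ is affine linear and $M$ is an affine plane.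
   Context: $\mathbb{R}^m_1$ denotes $\mathbb{R}^m$ with the Minkowski inner product $\langle \mathbf{u},\mathbf{v}\rangle=u_1v_1+\cdots+u_{m-1}v_{m-1}-u_mv_m$; a vector $\mathbf{y}$ is lightlike if $\langle\mathbf{y},\mathbf{y}\rangle=0$. Identify $\mathbb{R}^{2+m}_1=\mathbb{R}^2\oplus\mathbb{R}^m_1$, where $\mathbb{R}^2$ carries the Euclidean inner product. For smooth $f:\mathbb{R}^2\to\mathbb{R}^m_1$, put $p=\partial f/\partial x_1$, $q=\partial f/\partial x_2$. The induced metric on $M=\operatorname{graph} f\subset\mathbb{R}^{2+m}_1$ in the global coordinates $(x_1,x_2)$ is $g=g_{ij}dx_idx_j$ with $g_{11}=1+\langle p,p\rangle$, $g_{22}=1+\langle q,q\rangle$, $g_{12}=g_{21}=\langle p,q\rangle$. $M$ is spacelike if $(g_{ij})$ is positive definite at every point; then $W:=\det(g_{ij})^{1/2}>0$. A spacelike surface is stationary if its mean curvature vector field vanishes identically; equivalently, all coordinate functions of $\mathbb{R}^{2+m}_1$ restricted to $M$ are harmonic for the Laplace–Beltrami operator $\Delta F=W^{-1}\partial_i(Wg^{ij}\partial_jF)$ of $g$, where $(g^{ij})=(g_{ij})^{-1}$. $\mathcal{P}_0:\mathbb{R}^{2+m}_1\to\mathbb{R}^2$ is the projection onto the first two coordinates; the Jacobian determinant of $\mathcal{P}_0|_M$ is $W^{-1}$. ''Harmonic function on $\mathbb{R}^2$'' refers to the standard Euclidean Laplacian in $(x_1,x_2)$. *)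

(* Defs.v *)
From Stdlib Require Import Reals.
From Coquelicot Require Import Coquelicot.
From mathcomp Require Import all_boot all_order all_algebra.
From mathcomp Require Import Rstruct.

Set Implicit Arguments.
Unset Strict Implicit.
Unset Printing Implicit Defensive.

Import Order.TTheory GRing.Theory Num.Theory.
Local Open Scope ring_scope.

(* Stdlib's real numbers R, with the algebraic structure of Rstruct, so that
   vectors of R^n are 'rV[R]_n.  Maps defined on R^2 are curried, as in
   Coquelicot's two-variable calculus. *)

Definition pderiv (i : 'I_2) (h : R -> R -> R) (x1 x2 : R) : R :=
  if i == 0 then Derive (fun t => h t x2) x1 else Derive (fun t => h x1 t) x2.

Definition vpderiv n (i : 'I_2) (F : R -> R -> 'rV[R]_n) (x1 x2 : R) :
    'rV[R]_n :=
  \row_k pderiv i (fun s t => F s t 0 k) x1 x2.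

(* [ex_diff_n h r x1 x2] for all points says that h is of class C^r *)
Definition smooth n (F : R -> R -> 'rV[R]_n) : Prop :=
  forall (k : 'I_n) (r : nat) (x1 x2 : R),
    ex_diff_n (fun s t => F s t 0 k) r x1 x2.

Definition harmonic (h : R -> R -> R) : Prop :=
  (forall x1 x2, ex_diff_n h 2 x1 x2) /\
  (forall x1 x2, \sum_(i < 2) pderiv i (pderiv i h) x1 x2 = 0).

Definition affine_linear (V : lmodType R) (F : R -> R -> V) : Prop :=
  exists a b c : V, forall x1 x2, F x1 x2 = x1 *: a + x2 *: b + c.

(* The minus sign is on the last coordinate. *)
Definition minkowski n (u v : 'rV[R]_n) : R :=
  \sum_(k < n) (-1) ^+ (k.+1 == n) * (u 0 k * v 0 k).

Definition lightlike n (y : 'rV[R]_n) : Prop := minkowski y y = 0.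

Section Surface.

Variables (n : nat) (X : R -> R -> 'rV[R]_n).

Definition metric (x1 x2 : R) : 'M[R]_2 :=
  \matrix_(i, j) minkowski (vpderiv i X x1 x2) (vpderiv j X x1 x2).

Definition spacelike : Prop :=
  forall (x1 x2 : R) (v : 'rV[R]_2), v != 0 ->
    0 < (v *m metric x1 x2 *m v^T) 0 0.

Definition area_density (x1 x2 : R) : R := Num.sqrt (\det (metric x1 x2)).

(* v minus its tangential part g^{kl} <v, d_k X> d_l X: the orthogonal
   projection onto the normal space wherever the metric is nondegenerate *)
Definition normal_part (x1 x2 : R) (v : 'rV[R]_n) : 'rV[R]_n :=
  v - \sum_(k < 2) \sum_(l < 2)
        (invmx (metric x1 x2) k l * minkowski v (vpderiv k X x1 x2))
          *: vpderiv l X x1 x2.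

Definition second_fundamental_form (i j : 'I_2) (x1 x2 : R) : 'rV[R]_n :=
  normal_part x1 x2 (vpderiv i (vpderiv j X) x1 x2).

(* Normalized as the trace, not half of it, of the second fundamental form *)
Definition mean_curvature (x1 x2 : R) : 'rV[R]_n :=
  \sum_(i < 2) \sum_(j < 2)
    invmx (metric x1 x2) i j *: second_fundamental_form i j x1 x2.

Definition stationary : Prop := forall x1 x2, mean_curvature x1 x2 = 0.

End Surface.

(* R^2 (+) R^m_1 is identified with R^(2 + m)_1, whose last coordinate is that
   of R^m_1 when 0 < m. *)
Definition graph_param m (f : R -> R -> 'rV[R]_m) (x1 x2 : R) :
    'rV[R]_(2 + m) :=
  row_mx (\row_(i < 2) (if i == 0 then x1 else x2)) (f x1 x2).

Definition graph m (f : R -> R -> 'rV[R]_m) (z : 'rV[R]_(2 + m)) : Prop :=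
  exists x1 x2, z = graph_param f x1 x2.

Definition affine_plane n (S : 'rV[R]_n -> Prop) : Prop :=
  exists z0 u v : 'rV[R]_n,
    row_free (col_mx u v) /\
    (forall z, S z <-> exists s t : R, z = z0 + s *: u + t *: v).

(* The Jacobian determinant of the projection of the graph onto R^2 is the
   inverse of the area density W of the induced metric. *)
Definition proj_area_increasing m (f : R -> R -> 'rV[R]_m) : Prop :=
  forall x1 x2, area_density (graph_param f) x1 x2 <= 1.

Definition proj_strictly_area_increasing m (f : R -> R -> 'rV[R]_m) : Prop :=
  forall x1 x2, area_density (graph_param f) x1 x2 < 1.

(* Main.v *)
(* Harmonicity of the coordinates x1, x2 says that P = g / sqrt(det g) is
   divergence free up to rotation, and det P = 1.  The function
   q = (P22 - P11 + 2 i P12) / (2 + tr P) then satisfies |q| < 1 and is holomorphic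
   for the conformal structure of g; moreover (1 + P)^2 is a flat metric of the same
   conformal class which dominates the Euclidean metric.  Bernstein's gradient
   estimate for this flat metric gives Liouville's theorem for bounded functions
   which are holomorphic in this sense; applied to q, it shows that P is constant.

   In isothermal coordinates the components phi_k of the gradient of f are then
   entire, and W <= 1 becomes sum_k |phi_k|^2 <= - |q|^2 in the Minkowski signature,
   up to a constant factor.  If q <> 0, the time component has no zero and the
   ratios of the other components to it are bounded by 1, hence constant; since
   <phi, phi> is a nonzero constant, phi is constant and f is affine.  If q = 0,
   then <phi, phi> = 0, and pointwise algebra forces W = 1 and all the ratios to
   the time component to be real, hence locally constant; unique continuation makes
   them constant, and they form a lightlike vector. *)
Require Import Defs.
From Stdlib Require Import Reals Lra Psatz FunctionalExtensionality IndefiniteDescription ProofIrrelevance Classical.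
From Coquelicot Require Import Coquelicot.
From mathcomp Require Import all_boot all_order all_algebra.
From mathcomp Require Import Rstruct.
Import Order.TTheory GRing.Theory Num.Theory.

(** * Smooth functions on the plane *)

Local Open Scope R_scope.

(** A priori the conformal structure of g could be that of a disk, where bounded holomorphic
    functions abound. Uniformization is avoided by never choosing isothermal coordinates: the rows
    of 2 (1 + P)^-1 serve as vector fields, and holomorphy means Cauchy-Riemann equations along
    them. As these fields commute, the identities for the Laplacians of |F|^2 and |F'|^2 are the
    usual ones; as |q| < 1 bounds their coefficients, Euclidean disks of every radius carry good
    cutoffs, and such disks exist because the graph is entire.

    Liouville's theorem serves three times: for q, for the ratios phi_k / phi_t to the time
    component, and for phi_t itself, whose modulus turns out to be constant. The dichotomy comes
    from <phi, phi> = -4 q. For q = 0 zeros of phi_t cannot be excluded, so a ratio is defined only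
    locally and has to be continued through phi_k - c_k phi_t. That continuation is again a maximum
    principle, for |F|^2 times high powers of a radial weight. *)

Definition Ck (n : nat) (f : R -> R -> R) : Prop :=
  forall x y, ex_diff_n f n x y.

Definition dx (f : R -> R -> R) (x y : R) : R := Derive (fun t => f t y) x.
Definition dy (f : R -> R -> R) (x y : R) : R := Derive (fun t => f x t) y.

Definition derivable2 (f : R -> R -> R) : Prop :=
  forall x y, ex_derive (fun t => f t y) x /\ ex_derive (fun t => f x t) y.

Definition continuous2 (f : R -> R -> R) : Prop :=
  forall x y, continuity_2d_pt f x y.

Lemma CkS n f :
  Ck n.+1 f <-> [/\ continuous2 f, derivable2 f, Ck n (dx f) & Ck n (dy f)].
Proof.
split=> [Hf|[Hc Hd Hx Hy] x y].
  by split=> x y; case: (Hf x y) => // ? [? [? [? ?]]].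
by split; [exact: Hc | case: (Hd x y) => ? ?; split].
Qed.

Lemma Ck_continuous2 n f : Ck n f -> continuous2 f.
Proof. by move=> Hf x y; move: (Hf x y); case: n {Hf} => [|n] []. Qed.

Lemma Ck_pred n f : Ck n.+1 f -> Ck n f.
Proof. by move=> Hf x y; apply: (ex_diff_n_m n.+1) (Hf x y); apply: le_S. Qed.

Lemma derivable2_add f g : derivable2 f -> derivable2 g ->
  derivable2 (fun x y => f x y + g x y).
Proof.
by move=> Hf Hg x y; case: (Hf x y) (Hg x y) => ? ? [? ?]; split;
  apply: ex_derive_plus.
Qed.

Lemma dx_add f g : derivable2 f -> derivable2 g ->
  dx (fun x y => f x y + g x y) = fun x y => dx f x y + dx g x y.
Proof.
move=> Hf Hg; apply: functional_extensionality => x.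
apply: functional_extensionality => y; case: (Hf x y) (Hg x y) => ? ? [? ?].
exact: Derive_plus.
Qed.

Lemma dy_add f g : derivable2 f -> derivable2 g ->
  dy (fun x y => f x y + g x y) = fun x y => dy f x y + dy g x y.
Proof.
move=> Hf Hg; apply: functional_extensionality => x.
apply: functional_extensionality => y; case: (Hf x y) (Hg x y) => ? ? [? ?].
exact: Derive_plus.
Qed.

Lemma Ck_add n f g : Ck n f -> Ck n g -> Ck n (fun x y => f x y + g x y).
Proof.
elim: n f g => [|n IH] f g Hf Hg.
  by move=> x y; split=> //; apply: continuity_2d_pt_plus;
    [case: (Hf x y) | case: (Hg x y)].
move/CkS: Hf => [fc fd fx fy]; move/CkS: Hg => [gc gd gx gy]; apply/CkS; split.
- by move=> x y; apply: continuity_2d_pt_plus.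
- exact: derivable2_add.
- by rewrite dx_add //; apply: IH.
- by rewrite dy_add //; apply: IH.
Qed.

Lemma derivable2_mul f g : derivable2 f -> derivable2 g ->
  derivable2 (fun x y => f x y * g x y).
Proof.
by move=> Hf Hg x y; case: (Hf x y) (Hg x y) => ? ? [? ?]; split;
  apply: ex_derive_mult.
Qed.

Lemma dx_mul f g : derivable2 f -> derivable2 g ->
  dx (fun x y => f x y * g x y) =
  fun x y => dx f x y * g x y + f x y * dx g x y.
Proof.
move=> Hf Hg; apply: functional_extensionality => x.
apply: functional_extensionality => y; case: (Hf x y) (Hg x y) => ? ? [? ?].
exact: Derive_mult.
Qed.

Lemma dy_mul f g : derivable2 f -> derivable2 g ->
  dy (fun x y => f x y * g x y) =
  fun x y => dy f x y * g x y + f x y * dy g x y.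
Proof.
move=> Hf Hg; apply: functional_extensionality => x.
apply: functional_extensionality => y; case: (Hf x y) (Hg x y) => ? ? [? ?].
exact: Derive_mult.
Qed.

Lemma Ck_mul n f g : Ck n f -> Ck n g -> Ck n (fun x y => f x y * g x y).
Proof.
elim: n f g => [|n IH] f g Hf Hg.
  by move=> x y; split=> //; apply: continuity_2d_pt_mult;
    [case: (Hf x y) | case: (Hg x y)].
have Hf' := Ck_pred _ _ Hf; have Hg' := Ck_pred _ _ Hg.
move/CkS: Hf => [fc fd fx fy]; move/CkS: Hg => [gc gd gx gy]; apply/CkS; split.
- by move=> x y; apply: continuity_2d_pt_mult.
- exact: derivable2_mul.
- by rewrite dx_mul //; apply: Ck_add; apply: IH.
- by rewrite dy_mul //; apply: Ck_add; apply: IH.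
Qed.

Lemma dx_const c : dx (fun _ _ => c) = fun _ _ => 0.
Proof. by do 2 apply: functional_extensionality => ?; apply: Derive_const. Qed.

Lemma dy_const c : dy (fun _ _ => c) = fun _ _ => 0.
Proof. by do 2 apply: functional_extensionality => ?; apply: Derive_const. Qed.

Lemma Ck_const n c : Ck n (fun _ _ => c).
Proof.
elim: n c => [|n IH] c; first by split=> //; apply: continuity_2d_pt_const.
apply/CkS; split.
- by move=> x y; apply: continuity_2d_pt_const.
- by move=> x y; split; apply: ex_derive_const.
- by rewrite dx_const.
- by rewrite dy_const.
Qed.

Lemma Ck_fst n : Ck n (fun x _ => x).
Proof.
case: n => [|n]; first by split=> //; apply: continuity_2d_pt_id1.
apply/CkS; split.
- by move=> x y; apply: continuity_2d_pt_id1.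
- by move=> x y; split; [apply: ex_derive_id | apply: ex_derive_const].
- rewrite (_ : dx _ = fun _ _ => 1); first exact: Ck_const.
  by do 2 apply: functional_extensionality => ?; apply: Derive_id.
- rewrite (_ : dy _ = fun _ _ => 0); first exact: Ck_const.
  by do 2 apply: functional_extensionality => ?; apply: Derive_const.
Qed.

Lemma Ck_snd n : Ck n (fun _ y => y).
Proof.
case: n => [|n]; first by split=> //; apply: continuity_2d_pt_id2.
apply/CkS; split.
- by move=> x y; apply: continuity_2d_pt_id2.
- by move=> x y; split; [apply: ex_derive_const | apply: ex_derive_id].
- rewrite (_ : dx _ = fun _ _ => 0); first exact: Ck_const.
  by do 2 apply: functional_extensionality => ?; apply: Derive_const.
- rewrite (_ : dy _ = fun _ _ => 1); first exact: Ck_const.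
  by do 2 apply: functional_extensionality => ?; apply: Derive_id.
Qed.

Lemma derivable2_inv f : derivable2 f -> (forall x y, f x y <> 0) ->
  derivable2 (fun x y => / f x y).
Proof.
by move=> Hf f0 x y; case: (Hf x y) => ? ?; split; apply: ex_derive_inv.
Qed.

Lemma dx_inv f : derivable2 f -> (forall x y, f x y <> 0) ->
  dx (fun x y => / f x y) = fun x y => - 1 * dx f x y * (/ f x y * / f x y).
Proof.
move=> Hf f0; apply: functional_extensionality => x.
apply: functional_extensionality => y.
case: (Hf x y) => ? ?; rewrite /dx Derive_inv //; by field.
Qed.

Lemma dy_inv f : derivable2 f -> (forall x y, f x y <> 0) ->
  dy (fun x y => / f x y) = fun x y => - 1 * dy f x y * (/ f x y * / f x y).
Proof.
move=> Hf f0; apply: functional_extensionality => x.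
apply: functional_extensionality => y.
case: (Hf x y) => ? ?; rewrite /dy Derive_inv // -/(dy f x y); by field.
Qed.

Lemma Ck_inv n f : (forall x y, f x y <> 0) -> Ck n f ->
  Ck n (fun x y => / f x y).
Proof.
move=> f0; elim: n => [|n IH] Hf.
  by move=> x y; split=> //; apply: continuity_2d_pt_inv => //; case: (Hf x y).
have Hi := IH (Ck_pred _ _ Hf).
move/CkS: Hf => [fc fd fx fy]; apply/CkS; split.
- by move=> x y; apply: continuity_2d_pt_inv.
- exact: derivable2_inv.
- by rewrite dx_inv //; do 2!(apply: Ck_mul => //); apply: Ck_const.
- by rewrite dy_inv //; do 2!(apply: Ck_mul => //); apply: Ck_const.
Qed.

Lemma derivable2_sqrt f : derivable2 f -> (forall x y, 0 < f x y) ->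
  derivable2 (fun x y => sqrt (f x y)).
Proof.
move=> Hf f0 x y; case: (Hf x y) => [[a Ha] [b Hb]]; split.
  by exists (a / (2 * sqrt (f x y))); apply: is_derive_sqrt.
by exists (b / (2 * sqrt (f x y))); apply: is_derive_sqrt.
Qed.

Lemma dx_sqrt f : derivable2 f -> (forall x y, 0 < f x y) ->
  dx (fun x y => sqrt (f x y)) = fun x y => / 2 * dx f x y * / sqrt (f x y).
Proof.
move=> Hf f0; apply: functional_extensionality => x.
apply: functional_extensionality => y.
have [Hx _] := Hf x y.
have H : is_derive (fun t => f t y) x (dx f x y) by exact: Derive_correct.
rewrite [LHS](is_derive_unique _ _ _ (is_derive_sqrt _ _ _ H (f0 x y))).
by field; apply: Rgt_not_eq; apply: sqrt_lt_R0.
Qed.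

Lemma dy_sqrt f : derivable2 f -> (forall x y, 0 < f x y) ->
  dy (fun x y => sqrt (f x y)) = fun x y => / 2 * dy f x y * / sqrt (f x y).
Proof.
move=> Hf f0; apply: functional_extensionality => x.
apply: functional_extensionality => y.
have [_ Hy] := Hf x y.
have H : is_derive (fun t => f x t) y (dy f x y) by exact: Derive_correct.
rewrite [LHS](is_derive_unique _ _ _ (is_derive_sqrt _ _ _ H (f0 x y))).
by field; apply: Rgt_not_eq; apply: sqrt_lt_R0.
Qed.

Lemma Ck_sqrt n f : (forall x y, 0 < f x y) -> Ck n f ->
  Ck n (fun x y => sqrt (f x y)).
Proof.
move=> f0.
have c f' : (forall x y, 0 < f' x y) -> continuous2 f' ->
    continuous2 (fun x y => sqrt (f' x y)).
  move=> f'0 fc x y; apply: continuity_1d_2d_pt_comp => //.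
  by apply: continuity_pt_sqrt; apply: Rlt_le.
elim: n => [|n IH] Hf.
  by move=> x y; split=> //; apply: c => //; apply: (Ck_continuous2 0).
have Hi := IH (Ck_pred _ _ Hf).
have Hv : Ck n (fun x y => / sqrt (f x y)).
  by apply: Ck_inv => // x y; apply: Rgt_not_eq; apply: sqrt_lt_R0.
move/CkS: Hf => [fc fd fx fy]; apply/CkS; split.
- exact: c.
- exact: derivable2_sqrt.
- by rewrite dx_sqrt //; do 2!(apply: Ck_mul => //); apply: Ck_const.
- by rewrite dy_sqrt //; do 2!(apply: Ck_mul => //); apply: Ck_const.
Qed.

(** Bundling smoothness makes [Dx] and [Dy] total operators on a single type, so that the rules of
    differentiation become rewriting equalities without side conditions. *)
Record sfun := SFun { sfun_fun :> R -> R -> R; sfunP : forall n, Ck n sfun_fun }.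

Declare Scope sfun_scope.
Delimit Scope sfun_scope with SF.
Bind Scope sfun_scope with sfun.
Lemma sfun_eq (f g : sfun) : (forall x y, f x y = g x y) -> f = g.
Proof.
case: f g => f Hf [g Hg] /= H.
have E : f = g by do 2 apply: functional_extensionality => ?.
by case: _ / E in Hg *; congr SFun; apply: proof_irrelevance.
Qed.

Definition sconst (c : R) : sfun := SFun _ (fun n => Ck_const n c).
Definition sadd (f g : sfun) : sfun :=
  SFun _ (fun n => Ck_add n _ _ (sfunP f n) (sfunP g n)).
Definition smul (f g : sfun) : sfun :=
  SFun _ (fun n => Ck_mul n _ _ (sfunP f n) (sfunP g n)).
Definition sX : sfun := SFun _ Ck_fst.
Definition sY : sfun := SFun _ Ck_snd.
Definition sinv (f : sfun) (f0 : forall x y, f x y <> 0) : sfun :=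
  SFun _ (fun n => Ck_inv n _ f0 (sfunP f n)).
Definition ssqrt (f : sfun) (f0 : forall x y, 0 < f x y) : sfun :=
  SFun _ (fun n => Ck_sqrt n _ f0 (sfunP f n)).

Lemma sfun_derivable2 (f : sfun) : derivable2 f.
Proof. by have /CkS[] := sfunP f 1. Qed.

Lemma sfun_continuous2 (f : sfun) : continuous2 f.
Proof. exact: (Ck_continuous2 0 _ (sfunP f 0)). Qed.

Lemma sfun_dx (f : sfun) n : Ck n (dx f).
Proof. by have /CkS[] := sfunP f n.+1. Qed.

Lemma sfun_dy (f : sfun) n : Ck n (dy f).
Proof. by have /CkS[] := sfunP f n.+1. Qed.

Definition Dx (f : sfun) : sfun := SFun _ (sfun_dx f).
Definition Dy (f : sfun) : sfun := SFun _ (sfun_dy f).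

Notation "f + g" := (sadd f g) : sfun_scope.
Notation "f * g" := (smul f g) : sfun_scope.
(** Negation is a product with a constant, so a derivation needs no separate rule for it. *)
Notation "- f" := (smul (sconst (-1)) f) : sfun_scope.
Notation "f - g" := (sadd f (- g)) : sfun_scope.

Local Open Scope sfun_scope.

Lemma DxD f g : Dx (f + g) = Dx f + Dx g.
Proof.
by apply: sfun_eq => x y /=; rewrite dx_add //; apply: sfun_derivable2.
Qed.

Lemma DyD f g : Dy (f + g) = Dy f + Dy g.
Proof.
by apply: sfun_eq => x y /=; rewrite dy_add //; apply: sfun_derivable2.
Qed.

Lemma DxM f g : Dx (f * g) = Dx f * g + f * Dx g.
Proof.
by apply: sfun_eq => x y /=; rewrite dx_mul //; apply: sfun_derivable2.
Qed.

Lemma DyM f g : Dy (f * g) = Dy f * g + f * Dy g.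
Proof.
by apply: sfun_eq => x y /=; rewrite dy_mul //; apply: sfun_derivable2.
Qed.

Lemma DxC c : Dx (sconst c) = sconst 0.
Proof. by apply: sfun_eq => x y /=; rewrite dx_const. Qed.

Lemma DyC c : Dy (sconst c) = sconst 0.
Proof. by apply: sfun_eq => x y /=; rewrite dy_const. Qed.

Lemma DxX : Dx sX = sconst 1.
Proof. by apply: sfun_eq => x y /=; apply: Derive_id. Qed.

Lemma DxY : Dx sY = sconst 0.
Proof. by apply: sfun_eq => x y /=; apply: Derive_const. Qed.

Lemma DyX : Dy sX = sconst 0.
Proof. by apply: sfun_eq => x y /=; apply: Derive_const. Qed.

Lemma DyY : Dy sY = sconst 1.
Proof. by apply: sfun_eq => x y /=; apply: Derive_id. Qed.

Lemma DyDx f : Dy (Dx f) = Dx (Dy f).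
Proof.
apply: sfun_eq => x y; rewrite /= /dx /dy; symmetry; apply: Schwarz.
- exists (mkposreal 1 Rlt_0_1) => u v _ _.
  have [? ?] := sfun_derivable2 f u v.
  by have [? _] := sfun_derivable2 (Dy f) u v; have [_ ?] := sfun_derivable2 (Dx f) u v.
- exact: (sfun_continuous2 (Dx (Dy f))).
- exact: (sfun_continuous2 (Dy (Dx f))).
Qed.

Definition DE := (DxD, DyD, DxM, DyM, DxC, DyC, DxX, DxY, DyX, DyY).

Local Close Scope sfun_scope.

(** * The maximum principle *)

Lemma continuity_2d_pt_snd f x y :
  continuity_2d_pt f x y -> continuity_pt (f x) y.
Proof.
move=> Hf eps Heps; have [d Hd] := Hf (mkposreal eps Heps).
exists d; split; first exact: cond_pos.
move=> t [_ Ht]; apply: Hd => //.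
by rewrite Rminus_diag Rabs_R0; apply: cond_pos.
Qed.

(** Two applications of the one-variable theorem: the maximum over y is a continuous function of x,
    by uniform continuity of [f] on a compact rectangle. *)
Lemma square_max f x0 y0 r : 0 <= r -> continuous2 f ->
  exists x1 y1, [/\ Rabs (x1 - x0) <= r, Rabs (y1 - y0) <= r &
    forall x y, Rabs (x - x0) <= r -> Rabs (y - y0) <= r -> f x y <= f x1 y1].
Proof.
move=> r0 Hf.
have absP t t0 : Rabs (t - t0) <= r <-> t0 - r <= t <= t0 + r.
  by split=> [/Rabs_le_between|H]; [|apply/Rabs_le_between]; lra.
have Hm x : exists y1, (forall y, y0 - r <= y <= y0 + r -> f x y <= f x y1) /\
    y0 - r <= y1 <= y0 + r.
  apply: continuity_ab_maj; first lra.
  by move=> c _; apply: continuity_2d_pt_snd.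
have [m mP] := functional_choice _ Hm.
have Fc x : x0 - r <= x <= x0 + r -> continuity_pt (fun x => f x (m x)) x.
  move=> Hx eps Heps.
  have Heps2 : 0 < eps / 2 by lra.
  (* The rectangle is widened by 1 because continuity at an endpoint also concerns points outside
     the interval. *)
  have [d Hd] := uniform_continuity_2d f (x0 - r - 1) (x0 + r + 1) (y0 - r)
    (y0 + r) (fun x y _ _ => Hf x y) (mkposreal _ Heps2).
  exists (Rmin d 1); split; first by apply: Rmin_pos; [apply: cond_pos | lra].
  move=> t [_ /= Ht]; rewrite /R_dist in Ht *.
  have [Ht1 Ht2] : Rabs (t - x) < d /\ Rabs (t - x) < 1.
    by split; apply: Rlt_le_trans Ht _; [apply: Rmin_l | apply: Rmin_r].
  have Bt : x0 - r - 1 <= t <= x0 + r + 1 by move/Rabs_lt_between: Ht2; lra.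
  have Bx : x0 - r - 1 <= x <= x0 + r + 1 by lra.
  have [Mx1 Mx2] := mP x; have [Mt1 Mt2] := mP t.
  have z0 z : Rabs (z - z) < d by rewrite Rminus_diag Rabs_R0; apply: cond_pos.
  have := Hd x (m x) t (m x) Bx Mx2 Bt Mx2 Ht1 (z0 _).
  have := Hd x (m t) t (m t) Bx Mt2 Bt Mt2 Ht1 (z0 _).
  move=> /= /Rabs_lt_between E1 /Rabs_lt_between E2.
  have := Mx1 _ Mt2; have := Mt1 _ Mx2 => E3 E4.
  by apply: (Rle_lt_trans _ (eps / 2)); [apply/Rabs_le_between; lra | lra].
have [|x1 [Hx1 Bx1]] := continuity_ab_maj _ (x0 - r) (x0 + r) _ Fc; first lra.
exists x1, (m x1); split; [exact/absP | by apply/absP; case: (mP x1) |].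
move=> x y /absP Bx /absP By; apply: Rle_trans (Hx1 _ Bx).
by case: (mP x) => H _; apply: H.
Qed.

Lemma second_derivative_test (g g' : R -> R) d l : 0 < d ->
  (forall t, is_derive g t (g' t)) -> is_derive g' 0 l ->
  (forall t, Rabs t < d -> g t <= g 0) -> g' 0 = 0 /\ l <= 0.
Proof.
move=> d0 Hg Hg' Hmax.
have g'0 : g' 0 = 0.
  have pr : derivable_pt g 0 by exists (g' 0); apply/is_derive_Reals.
  have E : derive_pt g 0 pr = g' 0 by apply: derive_pt_eq_0; apply/is_derive_Reals.
  rewrite -E; apply: (deriv_maximum g (- d) d); [lra | lra |].
  by move=> x Hx1 Hx2; apply: Hmax; apply/Rabs_lt_between; lra.
split=> //; case: (Rle_lt_dec l 0) => // l0; exfalso.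
have /is_derive_Reals/(_ l l0)[e He] := Hg'.
pose h := Rmin d e / 2.
have h0 : 0 < h by rewrite /h; have := Rmin_pos _ _ d0 (cond_pos e); lra.
have [hd he] : h < d /\ h < e.
  by rewrite /h in h0 *; have := Rmin_l d e; have := Rmin_r d e; lra.
have [c [Hc [c0 ch]]] := MVT_cor2 g g' 0 h h0
  (fun t _ => proj1 (is_derive_Reals _ _ _) (Hg t)).
have c_pos : 0 < g' c.
  have c_neq0 : c <> 0 by lra.
  have ce : Rabs c < e by rewrite Rabs_pos_eq; lra.
  have /Rabs_lt_between := He c c_neq0 ce.
  rewrite Rplus_0_l g'0 Rminus_0_r => -[H _].
  have {}H : 0 < g' c / c by lra.
  rewrite (_ : g' c = g' c / c * c); last by field.
  exact: Rmult_lt_0_compat.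
have := Hmax h; rewrite Rabs_pos_eq; last lra.
move/(_ hd); have : 0 < g' c * (h - 0) by apply: Rmult_lt_0_compat; lra.
lra.
Qed.

Lemma sfun_derive_line (F : sfun) x y a b t :
  is_derive (fun s => F (x + s * a) (y + s * b)) t
    (a * Dx F (x + t * a) (y + t * b) + b * Dy F (x + t * a) (y + t * b)).
Proof.
apply/is_derive_Reals.
have H := derivable_pt_lim_comp_2d F (fun s => x + s * a) (fun s => y + s * b) t
  (Dx F (x + t * a) (y + t * b)) (Dy F (x + t * a) (y + t * b)) a b.
have E : forall p q, derivable_pt_lim (fun s => p + s * q) t q.
  by move=> p q; apply/is_derive_Reals; auto_derive => //; ring.
rewrite (Rmult_comm a) (Rmult_comm b); apply: H (E _ _) (E _ _).
apply/filterdiff_differentiable_pt_lim.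
apply: (is_derive_filterdiff F _ _ (Dx F)).
- apply: filter_forall => u.
  by have [Hu _] := sfun_derivable2 F u.1 u.2; apply: Derive_correct.
- have [_ Hv] := sfun_derivable2 F (x + t * a) (y + t * b).
  exact: Derive_correct.
- by have /continuity_2d_pt_filterlim := sfun_continuous2 (Dx F)
    (x + t * a) (y + t * b).
Qed.

Definition local_max (f : R -> R -> R) (x y : R) : Prop :=
  exists2 d, 0 < d &
    forall u v, Rabs (u - x) < d -> Rabs (v - y) < d -> f u v <= f x y.

Lemma local_max_hessian (F : sfun) x y a b : local_max F x y ->
  a * Dx F x y + b * Dy F x y = 0 /\
  a * a * Dx (Dx F) x y + 2 * (a * b) * Dx (Dy F) x y + b * b * Dy (Dy F) x y <= 0.
Proof.
move=> [d d0 Hd].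
pose G := sadd (smul (sconst a) (Dx F)) (smul (sconst b) (Dy F)).
pose k := Rabs a + Rabs b + 1.
have k0 : 0 < k by rewrite /k; have := Rabs_pos a; have := Rabs_pos b; lra.
have dk : 0 < d / k by apply: Rdiv_lt_0_compat.
have small c t : Rabs c < k -> Rabs t < d / k -> Rabs (t * c) < d.
  move=> Hc Ht; rewrite Rabs_mult (_ : d = d / k * k); last by field; lra.
  apply: Rle_lt_trans (_ : d / k * Rabs c < _).
    by apply: Rmult_le_compat_r; [apply: Rabs_pos | lra].
  exact: Rmult_lt_compat_l.
have [|E1 E2] := second_derivative_test
  (fun s => F (x + s * a) (y + s * b)) (fun s => G (x + s * a) (y + s * b))
  (d / k) _ dk (sfun_derive_line F x y a b) (sfun_derive_line G x y a b 0).
  move=> t Ht; rewrite !Rmult_0_l !Rplus_0_r; apply: Hd.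
    rewrite (_ : _ - x = t * a); last ring.
    by apply: small => //; rewrite /k; have := Rabs_pos b; lra.
  rewrite (_ : _ - y = t * b); last ring.
  by apply: small => //; rewrite /k; have := Rabs_pos a; lra.
move: E1 E2; rewrite !Rmult_0_l !Rplus_0_r /G !DE DyDx /= => E1 E2.
by split=> //; apply: Rle_trans E2; apply: Req_le; ring.
Qed.

(** * Liouville's theorem *)

(* An orthonormal frame of commuting vector fields, up to a factor, for a flat
   metric on the plane which dominates the Euclidean one and for which the two
   coordinates are harmonic. *)
Record frame := Frame {
  d1 : sfun -> sfun;
  d2 : sfun -> sfun;
  d1D : forall f g, d1 (f + g) = (d1 f + d1 g)%SF;
  d2D : forall f g, d2 (f + g) = (d2 f + d2 g)%SF;
  d1M : forall f g, d1 (f * g) = (d1 f * g + f * d1 g)%SF;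
  d2M : forall f g, d2 (f * g) = (d2 f * g + f * d2 g)%SF;
  d1C : forall c, d1 (sconst c) = sconst 0;
  d2C : forall c, d2 (sconst c) = sconst 0;
  d2d1 : forall f, d2 (d1 f) = d1 (d2 f);
  frame_harmonicX : forall x y, d1 (d1 sX) x y + d2 (d2 sX) x y = 0;
  frame_harmonicY : forall x y, d1 (d1 sY) x y + d2 (d2 sY) x y = 0;
  frame_bound : forall x y, d1 sX x y * d1 sX x y + d2 sX x y * d2 sX x y +
    (d1 sY x y * d1 sY x y + d2 sY x y * d2 sY x y) <= 4;
  frame_max : forall F x y, local_max (sfun_fun F) x y ->
    d1 (d1 F) x y + d2 (d2 F) x y <= 0;
  frame_span : forall F x y, d1 F x y = 0 -> d2 F x y = 0 ->
    Dx F x y = 0 /\ Dy F x y = 0 }.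

Lemma saddE (f g : sfun) x y : (f + g)%SF x y = f x y + g x y.
Proof. by []. Qed.

Lemma smulE (f g : sfun) x y : (f * g)%SF x y = f x y * g x y.
Proof. by []. Qed.

Lemma sconstE c x y : sconst c x y = c.
Proof. by []. Qed.

Lemma sXE x y : sX x y = x.
Proof. by []. Qed.

Lemma sYE x y : sY x y = y.
Proof. by []. Qed.

Definition evE := (saddE, smulE, sconstE, sXE, sYE).

Section Holomorphic.

Variable fr : frame.
Local Notation D1 := (d1 fr).
Local Notation D2 := (d2 fr).
Local Notation dE := (d1D, d2D, d1M, d2M, d1C, d2C, d2d1).

Definition holo (p r : sfun) : Prop := D1 p = D2 r /\ D2 p = (- D1 r)%SF.

(* Locked so that [saddE] does not see through it. *)
Definition lap (f : sfun) : sfun :=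
  locked (D1 (D1 f) + D2 (D2 f))%SF.

Lemma lapE f x y : lap f x y = D1 (D1 f) x y + D2 (D2 f) x y.
Proof. by rewrite /lap -lock. Qed.

Lemma lapD f g : lap (f + g) = (lap f + lap g)%SF.
Proof. by apply: sfun_eq => x y; rewrite saddE !lapE !dE !evE; ring. Qed.

Lemma lapM f g x y : lap (f * g) x y = lap f x y * g x y + f x y * lap g x y +
  2 * (D1 f x y * D1 g x y + D2 f x y * D2 g x y).
Proof. by rewrite !lapE !dE !evE; ring. Qed.

Lemma lapC c : lap (sconst c) = sconst 0.
Proof. by apply: sfun_eq => x y; rewrite lapE !dE !evE; ring. Qed.

Lemma lapZ c f : lap (sconst c * f) = (sconst c * lap f)%SF.
Proof. by apply: sfun_eq => x y; rewrite lapM lapC !dE !evE; ring. Qed.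

Lemma lapX : lap sX = sconst 0.
Proof. by apply: sfun_eq => x y; rewrite lapE; apply: frame_harmonicX. Qed.

Lemma lapY : lap sY = sconst 0.
Proof. by apply: sfun_eq => x y; rewrite lapE; apply: frame_harmonicY. Qed.

(** This is |F'|^2 for the holomorphic function F = p + i r, which its real part determines. *)
Definition grad2 (p : sfun) : sfun := (D1 p * D1 p + D2 p * D2 p)%SF.

Section CR.

Variables p r : sfun.
Hypothesis pr : holo p r.

Lemma holo_d1r : D1 r = (- D2 p)%SF.
Proof.
by case: pr => _ ->; apply: sfun_eq => x y; rewrite !evE; ring.
Qed.

Lemma holo_d22 : D2 (D2 p) = (- D1 (D1 p))%SF.
Proof. by case: pr => -> ->; rewrite !dE; apply: sfun_eq => x y; rewrite !evE; ring. Qed.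

Lemma holo_lap : lap p = sconst 0.
Proof. by apply: sfun_eq => x y; rewrite lapE holo_d22 !evE; ring. Qed.

Lemma lap_norm2 x y : lap (p * p + r * r) x y = 4 * grad2 p x y.
Proof.
have lap_r : lap r = sconst 0.
  by apply: sfun_eq => z t; rewrite lapE holo_d1r -(proj1 pr) !dE !evE; ring.
by rewrite lapD saddE !lapM lap_r holo_lap holo_d1r -(proj1 pr) !evE; ring.
Qed.

Lemma grad2_d1 x y : D1 (grad2 p) x y =
  2 * (D1 p x y * D1 (D1 p) x y + D2 p x y * D1 (D2 p) x y).
Proof. by rewrite !dE !evE; ring. Qed.

Lemma grad2_d2 x y : D2 (grad2 p) x y =
  2 * (D1 p x y * D1 (D2 p) x y - D2 p x y * D1 (D1 p) x y).
Proof. by rewrite !dE holo_d22 !evE; ring. Qed.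

Lemma lap_grad2 x y : lap (grad2 p) x y =
  4 * (D1 (D1 p) x y * D1 (D1 p) x y + D1 (D2 p) x y * D1 (D2 p) x y).
Proof.
rewrite /grad2 lapD saddE !lapM !lapE !dE holo_d22 !dE !evE.
ring.
Qed.
End CR.

(* Bernstein's method: [grad2 p], multiplied by the square of this cutoff, is
   bounded by the maximum principle. *)
Definition disk_cutoff a b R0 : sfun :=
  (sconst (R0 * R0) - ((sX - sconst a) * (sX - sconst a) +
    (sY - sconst b) * (sY - sconst b)))%SF.

(** By Cauchy-Schwarz the left side is at most 4 times the squared distance to (a, b) times the sum
    in [frame_bound], which is at most 4. *)
Lemma disk_cutoff_grad a b R0 x y : let c := disk_cutoff a b R0 in
  D1 c x y * D1 c x y + D2 c x y * D2 c x y <= 16 * (R0 * R0 - c x y).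
Proof.
rewrite /disk_cutoff /= !dE !evE; have := frame_bound fr x y.
move: (D1 sX x y) (D2 sX x y) (D1 sY x y) (D2 sY x y) => X1 X2 Y1 Y2 HB.
rewrite -[X in _ <= X]/(16 * (R0 * R0 - (R0 * R0 + -1 * ((x + -1 * a) * (x + -1 * a)
  + (y + -1 * b) * (y + -1 * b))))).
set X := x + -1 * a; set Y := y + -1 * b.
apply: Rle_trans (_ : 4 * (X * X + Y * Y) * (X1 * X1 + X2 * X2 + (Y1 * Y1 + Y2 * Y2))
   <= _); last first.
  have := Rle_0_sqr X; have := Rle_0_sqr Y; rewrite /Rsqr => ? ?.
  have := Rmult_le_compat_l (4 * (X * X + Y * Y)) _ _ _ HB; lra.
have := Rle_0_sqr (X * Y1 - Y * X1); have := Rle_0_sqr (X * Y2 - Y * X2).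
rewrite /Rsqr; lra.
Qed.

(** As the coordinates are harmonic, this Laplacian is -2 times the sum in [frame_bound]. *)
Lemma disk_cutoff_lap a b R0 x y : - 8 <= lap (disk_cutoff a b R0) x y.
Proof.
rewrite /disk_cutoff lapD lapC lapZ lapD !(saddE, smulE) !lapM !lapD !lapZ !lapC lapX lapY.
rewrite !dE !evE; have := frame_bound fr x y; lra.
Qed.

(** Completing the square in c F'' absorbs the cross term between the gradients of c^2 and |F'|^2,
    at the price of 4 |grad c|^2 |F'|^2. There remains (4 K + 2 c lap c - 2 |grad c|^2) |F'|^2,
    whose coefficient is at least (52 - 16 - 32) R2; this is the origin of 13. *)
Lemma bernstein_laplacian p r (c : sfun) R2 K x y : holo p r ->
  0 < c x y <= R2 -> 13 * R2 <= K -> - 8 <= lap c x y ->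
  D1 c x y * D1 c x y + D2 c x y * D2 c x y <= 16 * R2 ->
  4 * R2 * grad2 p x y <=
    lap (c * c * grad2 p + sconst K * (p * p + r * r)) x y.
Proof.
move=> pr c0 HK.
rewrite lapD lapZ saddE smulE sconstE (lap_norm2 _ _ pr) lapM lapM (lap_grad2 _ _ pr).
rewrite !(d1M, d2M) !(saddE, smulE) (grad2_d2 _ _ pr) grad2_d1.
move: (c x y) c0 (lap c x y) (D1 c x y) (D2 c x y) (D1 p x y) (D2 p x y)
  (D1 (D1 p) x y) (D1 (D2 p) x y) => C [c0 cR] L c1 c2 p1 p2 h1 h2 HL Hg.
have S0 : 0 <= p1 * p1 + p2 * p2 by nra.
have H1 := Rle_0_sqr (C * h1 + (c1 * p1 - c2 * p2)).
have H2 := Rle_0_sqr (C * h2 + (c1 * p2 + c2 * p1)).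
have H3 : 4 * R2 <= 4 * K + 2 * C * L - 2 * (c1 * c1 + c2 * c2) by nra.
have H4 := Rmult_le_compat_r _ _ _ S0 H3.
rewrite /Rsqr in H1 H2; apply: (Rle_trans _ _ _ H4).
by apply: Rminus_le; lra.
Qed.

Lemma gradient_estimate p r K R0 a b : holo p r -> 0 < R0 ->
  (forall x y, p x y * p x y + r x y * r x y <= K) ->
  R0 * R0 * grad2 p a b <= 13 * K.
Proof.
move=> pr R00 HK.
have R20 : 0 < R0 * R0 by nra.
pose c := disk_cutoff a b R0.
have cE x y : c x y = R0 * R0 - ((x - a) * (x - a) + (y - b) * (y - b)).
  by rewrite /c /= ; ring.
(* The maximum is taken over a square, near whose corners [c] is negative and c^2 positive; clipping
   removes the gradient term outside the disk. *)
have clip_cont : continuous2 (fun x y => Rmax (c x y) 0).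
  move=> x y; apply: (continuity_2d_pt_ext (fun x y => (c x y + Rabs (c x y)) * / 2)).
    by move=> u v; rewrite /Rmax /Rabs; case: Rle_dec; case: Rcase_abs; lra.
  apply: continuity_2d_pt_mult; last exact: continuity_2d_pt_const.
  apply: continuity_2d_pt_plus; first exact: sfun_continuous2.
  apply: continuity_1d_2d_pt_comp; last exact: sfun_continuous2.
  exact: Rcontinuity_abs.
pose N := (p * p + r * r)%SF.
pose KR := 13 * (R0 * R0).
pose F := (c * c * grad2 p + sconst KR * N)%SF.
pose Psi x y := Rmax (c x y) 0 * Rmax (c x y) 0 * grad2 p x y + KR * N x y.
have Psi_cont : continuous2 Psi.
  move=> x y; apply: continuity_2d_pt_plus.
    apply: continuity_2d_pt_mult; last exact: sfun_continuous2.
    by apply: continuity_2d_pt_mult; apply: clip_cont.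
  exact: (sfun_continuous2 (sconst KR * N)%SF).
have N0 x y : 0 <= N x y by rewrite /N !evE; nra.
have S0 x y : 0 <= grad2 p x y by rewrite /grad2 !evE; nra.
have PsiF x y : 0 < c x y -> Psi x y = F x y.
  by move=> H; rewrite /Psi Rmax_left //; apply: Rlt_le.
have [x1 [y1 [Hx1 Hy1 Hmax]]] := square_max Psi a b R0 (Rlt_le _ _ R00) Psi_cont.
have Psi1 : Psi x1 y1 <= KR * K.
  have HN : KR * N x1 y1 <= KR * K.
    by apply: Rmult_le_compat_l; [rewrite /KR; lra | exact: HK].
  case: (Rle_lt_dec (c x1 y1) 0) => Hc; first by rewrite /Psi Rmax_right //; lra.
  have lt_R0 t : t * t < R0 * R0 -> Rabs t < R0.
    by move=> H; rewrite -(Rabs_pos_eq R0); [apply: Rsqr_lt_abs_0 | lra].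
  have Fmax : local_max F x1 y1.
    have [d Hd] := sfun_continuous2 c x1 y1 (mkposreal _ Hc).
    have {}Hx1 : Rabs (x1 - a) < R0.
      by apply: lt_R0; move: (Hc) (Rle_0_sqr (y1 - b)); rewrite cE /Rsqr; lra.
    have {}Hy1 : Rabs (y1 - b) < R0.
      by apply: lt_R0; move: (Hc) (Rle_0_sqr (x1 - a)); rewrite cE /Rsqr; lra.
    exists (Rmin d (Rmin (R0 - Rabs (x1 - a)) (R0 - Rabs (y1 - b)))).
      by apply: Rmin_pos; [apply: cond_pos | apply: Rmin_pos; lra].
    move=> u v /Rmin_Rgt_l[u1 /Rmin_Rgt_l[u2 _]] /Rmin_Rgt_l[v1 /Rmin_Rgt_l[_ v2]].
    have /Rabs_lt_between cuv := Hd u v u1 v1.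
    have {cuv} [cuv _] : - c x1 y1 < c u v - c x1 y1 < c x1 y1 := cuv.
    have {}cuv : 0 < c u v by clear -cuv; lra.
    rewrite -!PsiF //; apply: Hmax.
      have := Rabs_triang (u - x1) (x1 - a).
      by rewrite (_ : u - x1 + (x1 - a) = u - a); [lra | ring].
    have := Rabs_triang (v - y1) (y1 - b).
    by rewrite (_ : v - y1 + (y1 - b) = v - b); [lra | ring].
  have HF := frame_max fr _ _ _ Fmax; rewrite -lapE in HF.
  have cR : c x1 y1 <= R0 * R0.
    rewrite cE; move: (Rle_0_sqr (x1 - a)) (Rle_0_sqr (y1 - b)); rewrite /Rsqr; lra.
  (* The maximum principle bounds the Laplacian of F above by 0 here, so [grad2 p] vanishes and only
     KR * N is left at the maximum. *)
  have HS : 4 * (R0 * R0) * grad2 p x1 y1 <= 0.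
    apply: Rle_trans HF; apply: bernstein_laplacian => //; first exact: Rle_refl.
      exact: disk_cutoff_lap.
    by apply: Rle_trans (disk_cutoff_grad a b R0 x1 y1) _; rewrite -/c; clear -Hc; lra.
  have S1 : grad2 p x1 y1 = 0 by have := S0 x1 y1; nra.
  by rewrite PsiF // /F saddE !smulE S1 sconstE; lra.
have := Hmax a b; rewrite !Rminus_diag Rabs_R0 => /(_ (Rlt_le _ _ R00) (Rlt_le _ _ R00)).
have cab : c a b = R0 * R0 by rewrite cE; ring.
rewrite (PsiF a b); last by rewrite cab.
rewrite /F saddE !smulE cab sconstE => HF.
have KN := Rmult_le_pos _ _ (_ : 0 <= KR) (N0 a b).
have {}KN : 0 <= KR * N a b by apply: KN; rewrite /KR; lra.
apply: (Rmult_le_reg_l (R0 * R0)) => //; rewrite /KR in KN HF Psi1; lra.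
Qed.

Lemma holo_liouville p r K : holo p r ->
  (forall x y, p x y * p x y + r x y * r x y <= K) ->
  D1 p = sconst 0 /\ D2 p = sconst 0.
Proof.
move=> pr HK.
have S0 x y : grad2 p x y <= 0.
  apply: Rnot_lt_le => S0.
  have K0 : 0 <= K by have := HK x y; nra.
  (* With S the value of [grad2 p] and q = 13 K / S, this radius yields (1 + q)^2 S <= q S, which is
     absurd. *)
  have H := gradient_estimate p r K (1 + 13 * K / grad2 p x y) x y pr.
  have Q0 : 0 <= 13 * K / grad2 p x y by apply: Rdiv_le_0_compat; lra.
  have {}H : _ := H ltac:(lra) HK.
  have E : 13 * K = 13 * K / grad2 p x y * grad2 p x y by field; lra.
  move: Q0 E H; set q := 13 * K / _ => Q0 E H; nra.
have sq x y : D1 p x y = 0 /\ D2 p x y = 0.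
  have := S0 x y; rewrite /grad2 saddE !smulE => H; split; nra.
by split; apply: sfun_eq => x y; case: (sq x y).
Qed.

End Holomorphic.

(** * The frame of a conformal structure *)

Section BeltramiFrame.

Variables u v : sfun.

(* For a metric [g] and [P = g / sqrt (det g)], this is the frame given by the
   rows of [2 (1 + P)^-1] when [u + i v = (P22 - P11 + 2 i P12) / (2 + tr P)]. *)
Definition bel1 (f : sfun) : sfun := ((sconst 1 + u) * Dx f - v * Dy f)%SF.
Definition bel2 (f : sfun) : sfun := ((sconst 1 - u) * Dy f - v * Dx f)%SF.

Lemma bel1E f x y :
  bel1 f x y = (1 + u x y) * Dx f x y - v x y * Dy f x y.
Proof. by rewrite /bel1 !evE; ring. Qed.

Lemma bel2E f x y :
  bel2 f x y = (1 - u x y) * Dy f x y - v x y * Dx f x y.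
Proof. by rewrite /bel2 !evE; ring. Qed.

Hypothesis uv1 : forall x y, u x y * u x y + v x y * v x y < 1.
Hypothesis cr1 : bel1 u = bel2 v.
Hypothesis cr2 : bel2 u = (- bel1 v)%SF.

Lemma bel1D f g : bel1 (f + g) = (bel1 f + bel1 g)%SF.
Proof. by rewrite /bel1 !DE; apply: sfun_eq => x y; rewrite !evE; ring. Qed.

Lemma bel2D f g : bel2 (f + g) = (bel2 f + bel2 g)%SF.
Proof. by rewrite /bel2 !DE; apply: sfun_eq => x y; rewrite !evE; ring. Qed.

Lemma bel1M f g : bel1 (f * g) = (bel1 f * g + f * bel1 g)%SF.
Proof. by rewrite /bel1 !DE; apply: sfun_eq => x y; rewrite !evE; ring. Qed.

Lemma bel2M f g : bel2 (f * g) = (bel2 f * g + f * bel2 g)%SF.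
Proof. by rewrite /bel2 !DE; apply: sfun_eq => x y; rewrite !evE; ring. Qed.

Lemma bel1C c : bel1 (sconst c) = sconst 0.
Proof. by rewrite /bel1 !DE; apply: sfun_eq => x y; rewrite !evE; ring. Qed.

Lemma bel2C c : bel2 (sconst c) = sconst 0.
Proof. by rewrite /bel2 !DE; apply: sfun_eq => x y; rewrite !evE; ring. Qed.

Lemma cr1E x y : (1 + u x y) * Dx u x y - v x y * Dy u x y -
  ((1 - u x y) * Dy v x y - v x y * Dx v x y) = 0.
Proof.
have := congr1 (fun f : sfun => f x y) cr1.
by rewrite /bel1 /bel2 !evE; lra.
Qed.

Lemma cr2E x y : (1 - u x y) * Dy u x y - v x y * Dx u x y +
  ((1 + u x y) * Dx v x y - v x y * Dy v x y) = 0.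
Proof.
have := congr1 (fun f : sfun => f x y) cr2.
by rewrite /bel1 /bel2 !evE; lra.
Qed.

(* The Cauchy-Riemann equations of [u + i v] say exactly that the two fields
   commute, and also that the coordinates are harmonic. *)
Lemma bel_comm f : bel2 (bel1 f) = bel1 (bel2 f).
Proof.
rewrite /bel1 /bel2 !DE !DyDx; apply: sfun_eq => x y; rewrite !evE.
apply: Rminus_diag_uniq.
transitivity (Dx f x y * ((1 - u x y) * Dy u x y - v x y * Dx u x y +
    ((1 + u x y) * Dx v x y - v x y * Dy v x y)) +
  Dy f x y * ((1 + u x y) * Dx u x y - v x y * Dy u x y -
    ((1 - u x y) * Dy v x y - v x y * Dx v x y))); first by ring.
by rewrite cr1E cr2E; ring.
Qed.

Lemma bel_harmonicX x y : bel1 (bel1 sX) x y + bel2 (bel2 sX) x y = 0.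
Proof. by have := cr1E x y; rewrite /bel1 /bel2 !DE !evE; lra. Qed.

Lemma bel_harmonicY x y : bel1 (bel1 sY) x y + bel2 (bel2 sY) x y = 0.
Proof. by have := cr2E x y; rewrite /bel1 /bel2 !DE !evE; lra. Qed.

(** The sum equals 2 + 2 (u^2 + v^2). *)
Lemma bel_bound x y :
  bel1 sX x y * bel1 sX x y + bel2 sX x y * bel2 sX x y +
  (bel1 sY x y * bel1 sY x y + bel2 sY x y * bel2 sY x y) <= 4.
Proof. by have := uv1 x y; rewrite /bel1 /bel2 !DE !evE; lra. Qed.

(** At a critical point the derivatives of the coefficients drop out, which leaves the Hessian
    evaluated on the two rows of the frame. *)
Lemma bel_max f x y : local_max (sfun_fun f) x y ->
  bel1 (bel1 f) x y + bel2 (bel2 f) x y <= 0.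
Proof.
move=> H.
have [fx _] := local_max_hessian f x y 1 0 H.
have [fy _] := local_max_hessian f x y 0 1 H.
have {}fx : Dx f x y = 0 by lra.
have {}fy : Dy f x y = 0 by lra.
have [_ H1] := local_max_hessian f x y (1 + u x y) (- v x y) H.
have [_ H2] := local_max_hessian f x y (- v x y) (1 - u x y) H.
rewrite /bel1 /bel2 !DE !DyDx !evE fx fy; lra.
Qed.

(** Cramer's rule: the frame has determinant 1 - u^2 - v^2. *)
Lemma bel_span f x y : bel1 f x y = 0 -> bel2 f x y = 0 ->
  Dx f x y = 0 /\ Dy f x y = 0.
Proof.
have := uv1 x y; rewrite /bel1 /bel2 !evE.
move: (u x y) (v x y) (Dx f x y) (Dy f x y) => U V fx fy H E1 E2.
have H0 : 1 - U * U - V * V <> 0 by lra.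
split; apply: (Rmult_eq_reg_l _ _ _ _ H0).
  transitivity ((1 - U) * ((1 + U) * fx + -1 * (V * fy)) +
    V * ((1 + -1 * U) * fy + -1 * (V * fx))); first by ring.
  by rewrite E1 E2; ring.
transitivity (V * ((1 + U) * fx + -1 * (V * fy)) +
    (1 + U) * ((1 + -1 * U) * fy + -1 * (V * fx))); first by ring.
by rewrite E1 E2; ring.
Qed.

Definition beltrami_frame : frame :=
  Frame bel1 bel2 bel1D bel2D bel1M bel2M bel1C bel2C bel_comm
    bel_harmonicX bel_harmonicY bel_bound bel_max bel_span.

End BeltramiFrame.

Lemma sfun_const (f : sfun) : Dx f = sconst 0 -> Dy f = sconst 0 ->
  f = sconst (f 0 0).
Proof.
move=> fx fy; apply: sfun_eq => x y; rewrite sconstE.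
have := MVT_cor2 (fun t => f (0 + t * x) (0 + t * y)) (fun=> 0) 0 1 Rlt_0_1.
case=> [t _|z [E _]].
  apply/is_derive_Reals; have := sfun_derive_line f 0 0 x y t.
  by rewrite fx fy !sconstE !Rmult_0_r Rplus_0_r.
by move: E; rewrite !Rmult_1_l !Rmult_0_l !Rplus_0_l; lra.
Qed.

Lemma frame_const (fr : frame) (f : sfun) :
  d1 fr f = sconst 0 -> d2 fr f = sconst 0 -> f = sconst (f 0 0).
Proof.
move=> f1 f2; apply: sfun_const; apply: sfun_eq => x y;
by have [] := frame_span fr f x y; rewrite ?f1 ?f2.
Qed.

(* Liouville's theorem applied to [u + i v], which is holomorphic for its own
   complex structure. *)
Lemma beltrami_const (u v : sfun)
    (uv1 : forall x y, u x y * u x y + v x y * v x y < 1) :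
  bel1 u v u = bel2 u v v -> bel2 u v u = (- bel1 u v v)%SF ->
  u = sconst (u 0 0) /\ v = sconst (v 0 0).
Proof.
move=> cr1 cr2; pose fr := beltrami_frame u v uv1 cr1 cr2.
have uv : holo fr u v by [].
have [|u1 u2] := holo_liouville fr u v 1 uv.
  by move=> x y; apply: Rlt_le.
have v2 : d2 fr v = sconst 0 by rewrite -u1.
have v1 : d1 fr v = sconst 0.
  by rewrite (holo_d1r fr _ _ uv) u2; apply: sfun_eq => x y; rewrite !evE; ring.
by split; apply: (frame_const fr).
Qed.

Section ConstFrame.

Variables U V : R.
Hypothesis UV1 : U * U + V * V < 1.

Lemma const_cr1 : bel1 (sconst U) (sconst V) (sconst U) =
  bel2 (sconst U) (sconst V) (sconst V).
Proof. by rewrite bel1C bel2C. Qed.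

Lemma const_cr2 : bel2 (sconst U) (sconst V) (sconst U) =
  (- bel1 (sconst U) (sconst V) (sconst V))%SF.
Proof.
by rewrite bel1C bel2C; apply: sfun_eq => x y; rewrite !evE; ring.
Qed.

Definition const_frame : frame :=
  beltrami_frame (sconst U) (sconst V) (fun _ _ => UV1) const_cr1 const_cr2.

End ConstFrame.

(** * Unique continuation *)

Section UniqueContinuation.

Lemma std_uv1 : 0 * 0 + 0 * 0 < 1.
Proof. lra. Qed.

Definition std_frame : frame := const_frame 0 0 std_uv1.

Lemma std_d1 f : d1 std_frame f = Dx f.
Proof. by apply: sfun_eq => x y; rewrite /=; ring. Qed.

Lemma std_d2 f : d2 std_frame f = Dy f.
Proof. by apply: sfun_eq => x y; rewrite /=; ring. Qed.

(** Subharmonicity of log f, cleared of denominators so that zeros are allowed. Unlike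
    subharmonicity of f, it survives products, hence arbitrary powers of a weight. *)
Definition log_subharmonic (f : sfun) (x y : R) : Prop :=
  0 <= f x y /\
  Dx f x y * Dx f x y + Dy f x y * Dy f x y <= f x y * lap std_frame f x y.

Lemma log_subharmonicM f g x y : log_subharmonic f x y ->
  log_subharmonic g x y -> log_subharmonic (f * g) x y.
Proof.
move=> [f0 Hf] [g0 Hg]; split; first by rewrite smulE; apply: Rmult_le_pos.
rewrite lapM !std_d1 !std_d2 !DE !evE.
move: (f x y) (g x y) (Dx f x y) (Dy f x y) (Dx g x y) (Dy g x y)
  (lap _ f x y) (lap _ g x y) f0 Hf g0 Hg => F G f1 f2 g1 g2 LF LG F0 HF G0 HG.
have := Rmult_le_compat_l _ _ _ (Rle_0_sqr F) HG.
have := Rmult_le_compat_l _ _ _ (Rle_0_sqr G) HF.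
by rewrite /Rsqr; lra.
Qed.

Lemma log_subharmonic1 x y : log_subharmonic (sconst 1) x y.
Proof. by split; rewrite ?lapC ?DE ?evE; lra. Qed.

Definition spow (f : sfun) n : sfun := iter n (smul f) (sconst 1).

Lemma spowE f n x y : spow f n x y = f x y ^ n.
Proof. by elim: n => //= n <-. Qed.

Lemma log_subharmonicX f n x y : log_subharmonic f x y ->
  log_subharmonic (spow f n) x y.
Proof.
move=> Hf; elim: n => [|n IH]; first exact: log_subharmonic1.
exact: log_subharmonicM.
Qed.

Lemma holo_log_subharmonic p r x y : holo std_frame p r ->
  log_subharmonic (p * p + r * r) x y.
Proof.
move=> pr; split; first by rewrite !evE; nra.
rewrite (lap_norm2 _ _ _ pr) -std_d1 -std_d2 d1D d2D !d1M !d2M.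
rewrite (holo_d1r _ _ _ pr) -(proj1 pr) /grad2 !evE.
by apply: Req_le; ring.
Qed.

Variables a b d : R.
Hypothesis d_gt0 : 0 < d.

Definition dist2 : sfun :=
  ((sX - sconst a) * (sX - sconst a) + (sY - sconst b) * (sY - sconst b))%SF.

Lemma dist2E x y : dist2 x y = (x - a) * (x - a) + (y - b) * (y - b).
Proof. by rewrite /dist2 !evE; ring. Qed.

Lemma dist2_ge0 x y : 0 <= dist2 x y.
Proof.
by rewrite dist2E; have := Rle_0_sqr (x - a); have := Rle_0_sqr (y - b); rewrite /Rsqr; lra.
Qed.

Definition shifted_dist2 : sfun := (dist2 + sconst (d / 2))%SF.

Lemma shifted_dist2_neq0 x y : shifted_dist2 x y <> 0.
Proof. by have := dist2_ge0 x y; rewrite /shifted_dist2 saddE sconstE; lra. Qed.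

(* A smooth substitute for the logarithmically harmonic weight [/ dist2]: it is
   log-subharmonic only where [d <= dist2]. *)
Definition weight : sfun := (sinv _ shifted_dist2_neq0 + sconst (/ d))%SF.

Lemma weightE x y : weight x y = / (dist2 x y + d / 2) + / d.
Proof. by []. Qed.

Lemma Dx_sinv f f0 : Dx (sinv f f0) = (- (Dx f * (sinv f f0 * sinv f f0)))%SF.
Proof.
apply: sfun_eq => x y; rewrite /= dx_inv //; last exact: sfun_derivable2.
by ring.
Qed.

Lemma Dy_sinv f f0 : Dy (sinv f f0) = (- (Dy f * (sinv f f0 * sinv f f0)))%SF.
Proof.
apply: sfun_eq => x y; rewrite /= dy_inv //; last exact: sfun_derivable2.
by ring.
Qed.

Lemma lap_dist2 x y : lap std_frame dist2 x y = 4.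
Proof. by rewrite lapE !std_d1 !std_d2 /dist2 !DE !evE; ring. Qed.

(** The shifted inverse h alone is log-superharmonic. Adding t = / d contributes a term of the right
    sign, proportional to t (1 - h d), which must beat h (h d / 2). Where d <= dist2 one has h d <=
    2/3 and h <= 2/3 t, so these terms are at least t/3 and at most 2t/9. *)
Lemma weight_log_subharmonic x y : d <= dist2 x y ->
  log_subharmonic weight x y.
Proof.
move=> Hd; set h := sinv _ shifted_dist2_neq0.
have h0 : 0 < h x y.
  by apply: Rinv_0_lt_compat; rewrite /shifted_dist2 saddE sconstE; lra.
have hE : h x y * (dist2 x y + d / 2) = 1.
  exact: (Rinv_l _ (shifted_dist2_neq0 x y)).
have d0 : 0 < / d by apply: Rinv_0_lt_compat.
split; first by rewrite /weight -/h saddE sconstE; lra.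
rewrite lapE !std_d1 !std_d2 /weight -/h !DxD !DyD !DxC !DyC.
have hx : Dx h = (sconst (-2) * ((sX - sconst a) * (h * h)))%SF.
  rewrite Dx_sinv /shifted_dist2 /dist2 !DE.
  by apply: sfun_eq => z t; rewrite !evE -/h; ring.
have hy : Dy h = (sconst (-2) * ((sY - sconst b) * (h * h)))%SF.
  rewrite Dy_sinv /shifted_dist2 /dist2 !DE.
  by apply: sfun_eq => z t; rewrite !evE -/h; ring.
rewrite hx hy !DE hx hy; clearbody h; rewrite !evE; move: hE Hd.
rewrite dist2E; move: (h x y) h0 => H H0 HE Hd; apply: Rminus_le.
have td : / d * d = 1 by apply: Rinv_l; lra.
move: (/ d) d0 td => t t0 td.
have HP : H * ((x - a) * (x - a) + (y - b) * (y - b)) = 1 - H * d / 2 by lra.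
have Hd3 : H * d <= 2 / 3 by nra.
have Ht : H <= 2 / 3 * t.
  rewrite (_ : H = H * d * t); first by apply: Rmult_le_compat_r; lra.
  by rewrite Rmult_assoc (Rmult_comm d) td; ring.
have E : 0 <= t * (1 - H * d) - H * (H * d / 2).
  have : H * (H * d / 2) <= H * (1 / 3) by apply: Rmult_le_compat_l; lra.
  have : t * (1 / 3) <= t * (1 - H * d) by apply: Rmult_le_compat_l; lra.
  lra.
have {}E : 0 <= 4 * (H * H) * (t * (1 - H * d) - H * (H * d / 2)).
  by apply: Rmult_le_pos => //; nra.
set P := H * _ in HP.
rewrite (_ : _ - _ = 4 * (H * H) * (H * (1 - P) + t * (1 - 2 * P))).
  by rewrite HP; lra.
by rewrite /P; ring.
Qed.

Lemma weight_gt0 x y : 0 < weight x y.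
Proof.
have d0 : 0 < / d by apply: Rinv_0_lt_compat.
rewrite weightE; have := dist2_ge0 x y => H.
by have := Rinv_0_lt_compat (dist2 x y + d / 2); lra.
Qed.

Lemma weight_lt x y x' y' : dist2 x y < dist2 x' y' ->
  weight x' y' < weight x y.
Proof.
move=> H; rewrite !weightE; apply: Rplus_lt_compat_r; apply: Rinv_lt_contravar; last lra.
by have H0 := dist2_ge0 x y; apply: Rmult_lt_0_compat; lra.
Qed.

Section HoloVanishing.

Variables p r : sfun.
Hypothesis pr : holo std_frame p r.
Hypothesis vanish : forall x y, dist2 x y < d -> p x y = 0 /\ r x y = 0.

Let N := (p * p + r * r)%SF.

(** N * weight^n vanishes where dist2 < d and is log-subharmonic elsewhere, so its maximum should
    sit at distance at least L. Adding e * dist2, of Laplacian 4 e, makes the subharmonicity strict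
    and excludes an interior maximum. *)
Lemma weighted_max_principle n e L M W : 0 < e -> 0 < L -> 0 <= M ->
  (forall x y, Rabs (x - a) <= L -> Rabs (y - b) <= L -> N x y <= M) ->
  (forall x y, L * L <= dist2 x y -> weight x y <= W) ->
  forall x y, Rabs (x - a) <= L -> Rabs (y - b) <= L ->
    N x y * weight x y ^ n <= M * W ^ n + e * (2 * (L * L)).
Proof.
move=> e0 L0 M0 HM HW.
pose F := (N * spow weight n + sconst e * dist2)%SF.
have [x1 [y1 [Hx1 Hy1 Hmax]]] :=
  square_max F a b L (Rlt_le _ _ L0) (sfun_continuous2 F).
have N0 x y : 0 <= N x y by rewrite /N !evE; nra.
have W0 : 0 <= W ^ n.
  apply: pow_le; apply: Rle_trans (HW (a + L) b _); first exact: Rlt_le (weight_gt0 _ _).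
  by rewrite dist2E; apply: Req_le; ring.
suff F1 : F x1 y1 <= M * W ^ n + e * (2 * (L * L)).
  move=> x y Hx Hy; apply: Rle_trans F1; apply: Rle_trans (Hmax _ _ Hx Hy).
  rewrite /F saddE !smulE sconstE spowE.
  by have := Rmult_le_pos _ _ (Rlt_le _ _ e0) (dist2_ge0 x y); lra.
have sqle t : Rabs t <= L -> t * t <= L * L.
  by move=> H; rewrite -(Rabs_pos_eq L) in H; [apply: Rsqr_le_abs_1 | lra].
have D1 : dist2 x1 y1 <= 2 * (L * L).
  by rewrite dist2E; have := sqle _ Hx1; have := sqle _ Hy1; lra.
have eD1 := Rmult_le_compat_l _ _ _ (Rlt_le _ _ e0) D1.
have FE : F x1 y1 = N x1 y1 * weight x1 y1 ^ n + e * dist2 x1 y1.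
  by rewrite /F saddE !smulE sconstE spowE.
have MW := Rmult_le_pos _ _ M0 W0.
case: (Rle_lt_dec (L * L) (dist2 x1 y1)) => HL.
  rewrite FE; apply: Rplus_le_compat => //; apply: Rmult_le_compat => //.
  - by apply: pow_le; apply: Rlt_le; apply: weight_gt0.
  - exact: HM.
  - by apply: pow_incr; split; [apply: Rlt_le; apply: weight_gt0 | apply: HW].
case: (Rle_lt_dec d (dist2 x1 y1)) => Hd; last first.
  have [p0 r0] := vanish _ _ Hd.
  have NE : N x1 y1 = 0 by rewrite /N !evE p0 r0; ring.
  by rewrite FE NE; lra.
pose f := (N * spow weight n)%SF.
have [f0 Hf] : log_subharmonic f x1 y1.
  apply: log_subharmonicM; first exact: holo_log_subharmonic.
  by apply: log_subharmonicX; apply: weight_log_subharmonic.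
(* Log-subharmonicity gives a nonnegative Laplacian only after division by f; where f = 0 the bound
   is immediate. *)
case: (Rle_lt_or_eq_dec _ _ f0) => [{}f0|E]; last first.
  by rewrite /F saddE -/f -E smulE sconstE; lra.
have Fmax : local_max F x1 y1.
  have lt_L t : t * t < L * L -> Rabs t < L.
    by move=> H; rewrite -(Rabs_pos_eq L); [apply: Rsqr_lt_abs_0 | lra].
  move: HL; rewrite dist2E => HL.
  have {}Hx1 : Rabs (x1 - a) < L.
    by apply: lt_L; have := Rle_0_sqr (y1 - b); rewrite /Rsqr; lra.
  have {}Hy1 : Rabs (y1 - b) < L.
    by apply: lt_L; have := Rle_0_sqr (x1 - a); rewrite /Rsqr; lra.
  exists (Rmin (L - Rabs (x1 - a)) (L - Rabs (y1 - b))).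
    by apply: Rmin_pos; lra.
  move=> u v /Rmin_Rgt_l[u2 _] /Rmin_Rgt_l[_ v2]; apply: Hmax.
    have := Rabs_triang (u - x1) (x1 - a).
    by rewrite (_ : u - x1 + (x1 - a) = u - a); [lra | ring].
  have := Rabs_triang (v - y1) (y1 - b).
  by rewrite (_ : v - y1 + (y1 - b) = v - b); [lra | ring].
have := frame_max std_frame _ _ _ Fmax.
rewrite -lapE /F lapD saddE lapZ smulE sconstE lap_dist2 -/f => lapF.
have sq := Rplus_le_le_0_compat _ _ (Rle_0_sqr (Dx f x1 y1)) (Rle_0_sqr (Dy f x1 y1)).
rewrite /Rsqr in sq.
have : 0 <= lap std_frame f x1 y1.
  by apply: (Rmult_le_reg_l (f x1 y1)) => //; lra.
lra.
Qed.

(** The weight is strictly larger at (x, y) than at distance L, so N weight^n <= M W^n for every n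
    forces N = 0 there. *)
Lemma holo_unique_continuation x y : p x y = 0 /\ r x y = 0.
Proof.
have N0 z t : 0 <= N z t by rewrite /N !evE; nra.
case: (Rlt_le_dec (dist2 x y) d) => Hd; first exact: vanish.
(* L is a distance and [dist2] a squared one; since L >= 1, this choice makes L * L exceed dist2 x
   y. *)
pose L := dist2 x y + 1.
have L1 : 1 <= L by have := dist2_ge0 x y; rewrite /L; lra.
have L0 : 0 < L by lra.
have [x1 [y1 [Hx1 Hy1 HM]]] :=
  square_max N a b L (Rlt_le _ _ L0) (sfun_continuous2 N).
pose W := weight (a + L) b.
have dL : dist2 (a + L) b = L * L by rewrite dist2E; ring.
have HW z t : L * L <= dist2 z t -> weight z t <= W.
  rewrite -dL /W; case/Rle_lt_or_eq_dec => H; first by apply: Rlt_le; apply: weight_lt.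
  by rewrite !weightE H; lra.
have W0 : 0 < W := weight_gt0 _ _.
have w0 := weight_gt0 x y.
have Ww : W < weight x y by apply: weight_lt; rewrite dL /L in L1 *; nra.
have leL t s : t * t + s <= L * L -> 0 <= s -> Rabs t <= L.
  by move=> H ?; rewrite -(Rabs_pos_eq L); [apply: Rsqr_le_abs_0; rewrite /Rsqr | ]; lra.
have Dxy : (x - a) * (x - a) + (y - b) * (y - b) <= L * L.
  by rewrite -dist2E; rewrite /L in L1 *; nra.
have Hx : Rabs (x - a) <= L.
  by apply: leL Dxy _; have := Rle_0_sqr (y - b).
have Hy : Rabs (y - b) <= L.
  by rewrite Rplus_comm in Dxy; apply: leL Dxy _; have := Rle_0_sqr (x - a).
pose M := N x1 y1.
have key n : N x y * weight x y ^ n <= M * W ^ n.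
  apply: le_epsilon => e e0.
  have := weighted_max_principle n (e / (2 * (L * L))) L M W _ L0 (N0 _ _) HM HW
    x y Hx Hy.
  rewrite (_ : e / (2 * (L * L)) * (2 * (L * L)) = e); last by field; lra.
  by apply; apply: Rdiv_lt_0_compat => //; nra.
suff Nxy : N x y = 0 by move: Nxy; rewrite /N !evE; split; nra.
apply: Rle_antisym; last exact: N0.
apply: Rnot_lt_le => Npos.
have M0 : 0 < M by apply: Rlt_le_trans Npos _; apply: HM.
pose q := W / weight x y.
have q0 : 0 < q by apply: Rdiv_lt_0_compat.
have q1 : Rabs q < 1.
  rewrite Rabs_pos_eq; last lra; apply: (Rmult_lt_reg_r (weight x y)) => //.
  by rewrite /q /Rdiv Rmult_assoc Rinv_l; lra.
have [n Hn] := pow_lt_1_zero q q1 (N x y / M) (Rdiv_lt_0_compat _ _ Npos M0).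
have {Hn} := Hn n (le_n n); rewrite Rabs_pos_eq; last by apply: pow_le; lra.
have wn : 0 < weight x y ^ n by apply: pow_lt.
move=> H; have := key n; apply: Rlt_not_le.
have -> : W ^ n = q ^ n * weight x y ^ n.
  by rewrite -Rpow_mult_distr /q; congr pow; field; lra.
rewrite -Rmult_assoc; apply: Rmult_lt_compat_r => //.
have -> : N x y = M * (N x y / M) by field; lra.
exact: Rmult_lt_compat_l.
Qed.

End HoloVanishing.
End UniqueContinuation.

(** * Isothermal coordinates of minimal graphs *)

(* [w] stands for the square root of [a * c - b * b], and [wi, ai, bi, ci] for
   partial derivatives; [Pij] and [Qij] are the products of the second
   derivatives of the surface with its two tangent vectors. *)
Lemma minimal_system_cr a b c w P11 P12 P22 Q11 Q12 Q22 J u v wx wy ux uy vx vy :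
  0 < a -> 0 < w -> 0 < J -> w * w = a * c - b * b ->
  c * P11 - 2 * b * P12 + a * P22 = 0 -> c * Q11 - 2 * b * Q12 + a * Q22 = 0 ->
  2 * w * wx = 2 * P11 * c + a * (2 * Q12) - 2 * b * (Q11 + P12) ->
  2 * w * wy = 2 * P12 * c + a * (2 * Q22) - 2 * b * (Q12 + P22) ->
  J = 2 * w + a + c -> u * J = c - a -> v * J = 2 * b ->
  ux * J + u * (2 * wx + 2 * P11 + 2 * Q12) = 2 * Q12 - 2 * P11 ->
  uy * J + u * (2 * wy + 2 * P12 + 2 * Q22) = 2 * Q22 - 2 * P12 ->
  vx * J + v * (2 * wx + 2 * P11 + 2 * Q12) = 2 * (Q11 + P12) ->
  vy * J + v * (2 * wy + 2 * P12 + 2 * Q22) = 2 * (Q12 + P22) ->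
  (1 + u) * ux - v * uy - ((1 - u) * vy - v * vx) = 0 /\
  (1 - u) * uy - v * ux + ((1 + u) * vx - v * vy) = 0.
Proof.
move=> a0 w0 J0 Hw HP HQ Hwx Hwy HJ Hu Hv Hux Huy Hvx Hvy.
have Ec : c = (w * w + b * b) / a by rewrite Hw; field; lra.
have EP : P22 = (2 * b * P12 - c * P11) / a.
  by apply: (Rmult_eq_reg_l a); [field_simplify; lra | lra].
have EQ : Q22 = (2 * b * Q12 - c * Q11) / a.
  by apply: (Rmult_eq_reg_l a); [field_simplify; lra | lra].
have Ewx : wx = (2 * P11 * c + a * (2 * Q12) - 2 * b * (Q11 + P12)) / (2 * w).
  by rewrite -Hwx; field; lra.
have Ewy : wy = (2 * P12 * c + a * (2 * Q22) - 2 * b * (Q12 + P22)) / (2 * w).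
  by rewrite -Hwy; field; lra.
have Eu : u = (c - a) / J by rewrite -Hu; field; lra.
have Ev : v = 2 * b / J by rewrite -Hv; field; lra.
have Eux : ux = (2 * Q12 - 2 * P11 - u * (2 * wx + 2 * P11 + 2 * Q12)) / J.
  by rewrite -Hux; field; lra.
have Euy : uy = (2 * Q22 - 2 * P12 - u * (2 * wy + 2 * P12 + 2 * Q22)) / J.
  by rewrite -Huy; field; lra.
have Evx : vx = (2 * (Q11 + P12) - v * (2 * wx + 2 * P11 + 2 * Q12)) / J.
  by rewrite -Hvx; field; lra.
have Evy : vy = (2 * (Q12 + P22) - v * (2 * wy + 2 * P12 + 2 * Q22)) / J.
  by rewrite -Hvy; field; lra.
(* This is a * J once c is eliminated, the form in which the denominator appears below. *)
have J1 : a * (2 * w) + a * a + (w * w + b * b) <> 0.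
  have -> : a * (2 * w) + a * a + (w * w + b * b) = a * J.
    by rewrite HJ Ec; field; lra.
  by apply: Rgt_not_eq; apply: Rmult_lt_0_compat.
clear Hw HP HQ Hwx Hwy Hu Hv Hux Huy Hvx Hvy J0.
subst ux uy vx vy u v J wx wy P22 Q22 c.
split; field; lra.
Qed.

(** Since det P = 1, Cayley-Hamilton gives (1 + P)^2 = (2 + tr P) P. Hence the rows of 2 (1 + P)^-1
    are orthogonal of equal length for g, and 4 (1 + P)^-2 is a multiple of g^-1, so that D1 D1 + D2
    D2 has the principal part of the minimal surface operator. *)
Lemma isothermal_identities a b c w J u v : 0 < a -> 0 < w -> 0 < J ->
  w * w = a * c - b * b -> J = 2 * w + a + c -> u * J = c - a -> v * J = 2 * b ->
  let l := w * (1 - u * u - v * v) in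
  [/\ u * u + v * v < 1,
      [/\ (1 + u) * (1 + u) * a - 2 * ((1 + u) * v) * b + v * v * c = l,
          v * v * a - 2 * ((1 - u) * v) * b + (1 - u) * (1 - u) * c = l &
          - ((1 + u) * v) * a + ((1 + u) * (1 - u) + v * v) * b
            - v * (1 - u) * c = 0] &
      [/\ (1 + u) * (1 + u) + v * v = 4 / J * c, 4 * v = 4 / J * (2 * b) &
          (1 - u) * (1 - u) + v * v = 4 / J * a]].
Proof.
move=> a0 w0 J0 Hw HJ Hu Hv.
have Ec : c = (w * w + b * b) / a by rewrite Hw; field; lra.
have Eu : u = (c - a) / J by rewrite -Hu; field; lra.
have Ev : v = 2 * b / J by rewrite -Hv; field; lra.
have J1 : a * (2 * w) + a * a + (w * w + b * b) <> 0.
  have -> : a * (2 * w) + a * a + (w * w + b * b) = a * J.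
    by rewrite HJ Ec; field; lra.
  by apply: Rgt_not_eq; apply: Rmult_lt_0_compat.
split.
- apply: Rminus_gt_0_lt.
  have -> : 1 - (u * u + v * v) = 4 * w / J.
    by clear Hw Hu Hv J0; subst u v J c; field; lra.
  by apply: Rdiv_lt_0_compat; lra.
- by clear Hw Hu Hv J0; subst u v J c; split; field; lra.
- by clear Hw Hu Hv J0; subst u v J c; split; field; lra.
Qed.

(** * Inner products of arbitrary signature *)

Section Form.

Context {n : nat} (eps : 'I_n -> R).

Definition dot (x y : 'I_n -> R) : R :=
  \big[Rplus/0]_(k < n) (eps k * (x k * y k)).

Lemma dotC x y : dot x y = dot y x.
Proof. by apply: eq_bigr => k _; rewrite (Rmult_comm (x k)). Qed.

Lemma eq_dotr x y z : y =1 z -> dot x y = dot x z.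
Proof. by move=> yz; apply: eq_bigr => k _; rewrite yz. Qed.

Lemma sumD (F G : 'I_n -> R) : \big[Rplus/0]_(k < n) F k +
  \big[Rplus/0]_(k < n) G k = \big[Rplus/0]_(k < n) (F k + G k).
Proof. by rewrite -big_split. Qed.

Lemma dotDr x y z : dot x (fun k => y k + z k) = dot x y + dot x z.
Proof. by rewrite /dot sumD; apply: eq_bigr => k _; ring. Qed.

Lemma dotZr t x y : dot x (fun k => t * y k) = t * dot x y.
Proof. by rewrite /dot big_distrr; apply: eq_bigr => k _ /=; ring. Qed.

Lemma dotDl x y z : dot (fun k => x k + y k) z = dot x z + dot y z.
Proof. by rewrite !(dotC _ z) dotDr. Qed.

Lemma dotZl t x y : dot (fun k => t * x k) y = t * dot x y.
Proof. by rewrite !(dotC _ y) dotZr. Qed.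

Definition form (p q : 'I_n -> sfun) : sfun :=
  \big[sadd/sconst 0]_(k < n) (sconst (eps k) * (p k * q k))%SF.

Lemma formE p q x y : form p q x y = dot (fun k => p k x y) (fun k => q k x y).
Proof. by rewrite /form (big_morph (fun f : sfun => f x y) (op1 := Rplus) (id1 := 0)). Qed.

Lemma Dx_form p q x y : Dx (form p q) x y =
  dot (fun k => Dx (p k) x y) (fun k => q k x y) +
  dot (fun k => p k x y) (fun k => Dx (q k) x y).
Proof.
rewrite /form (big_morph Dx DxD (DxC 0)) (big_morph (fun f : sfun => f x y)
  (op1 := Rplus) (id1 := 0)) // sumD.
by apply: eq_bigr => k _; rewrite !DE !evE; ring.
Qed.

Lemma Dy_form p q x y : Dy (form p q) x y =
  dot (fun k => Dy (p k) x y) (fun k => q k x y) +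
  dot (fun k => p k x y) (fun k => Dy (q k) x y).
Proof.
rewrite /form (big_morph Dy DyD (DyC 0)) (big_morph (fun f : sfun => f x y)
  (op1 := Rplus) (id1 := 0)) // sumD.
by apply: eq_bigr => k _; rewrite !DE !evE; ring.
Qed.

End Form.

(** Differentiating the implicit equations for w, u and v avoids derivatives of roots and quotients;
    the derivation is abstract so as to cover both [Dx] and [Dy]. *)
Lemma isothermal_derivation (D : sfun -> sfun)
    (DD : forall f g, D (f + g)%SF = (D f + D g)%SF)
    (DM : forall f g, D (f * g)%SF = (D f * g + f * D g)%SF)
    (DC : forall c, D (sconst c) = sconst 0) (a b c w J u v : sfun) x y :
  (w * w = a * c - b * b)%SF -> (J = sconst 2 * w + a + c)%SF ->
  (u * J = c - a)%SF -> (v * J = sconst 2 * b)%SF ->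
  [/\ 2 * w x y * D w x y =
        D a x y * c x y + a x y * D c x y - 2 * b x y * D b x y,
      D u x y * J x y + u x y * (2 * D w x y + D a x y + D c x y) =
        D c x y - D a x y &
      D v x y * J x y + v x y * (2 * D w x y + D a x y + D c x y) =
        2 * D b x y].
Proof.
move=> Hw HJ Hu Hv.
have EJ : D J x y = 2 * D w x y + D a x y + D c x y.
  by rewrite HJ !DD DM DC !evE; ring.
rewrite -EJ; have ev f g : f = g -> D f x y = D g x y by move=> ->.
move/ev: Hw; move/ev: Hu; move/ev: Hv.
by rewrite !DD !DM !DC !evE => -> -> Hw; split; lra.
Qed.

Section MinimalSystem.

Context {n : nat} (eps : 'I_n -> R) (f : 'I_n -> sfun).

Definition g11 : sfun := (sconst 1 + form eps (fun k => Dx (f k)) (fun k => Dx (f k)))%SF.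
Definition g12 : sfun := form eps (fun k => Dx (f k)) (fun k => Dy (f k)).
Definition g22 : sfun := (sconst 1 + form eps (fun k => Dy (f k)) (fun k => Dy (f k)))%SF.
Definition detg : sfun := (g11 * g22 - g12 * g12)%SF.

Hypothesis g11_gt0 : forall x y, 0 < g11 x y.
Hypothesis detg_gt0 : forall x y, 0 < detg x y.
Hypothesis f_minimal : forall k x y,
  g22 x y * Dx (Dx (f k)) x y - 2 * g12 x y * Dx (Dy (f k)) x y +
  g11 x y * Dy (Dy (f k)) x y = 0.

Lemma detgE x y : detg x y = g11 x y * g22 x y - g12 x y * g12 x y.
Proof. by rewrite /detg !(saddE, smulE, sconstE); ring. Qed.

Let w := ssqrt detg detg_gt0.

Lemma area_gt0 x y : 0 < w x y.
Proof. exact: sqrt_lt_R0. Qed.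

Lemma area_sqr x y : w x y * w x y = g11 x y * g22 x y - g12 x y * g12 x y.
Proof.
rewrite [w x y]/(sqrt (detg x y)) sqrt_def; last exact: Rlt_le.
exact: detgE.
Qed.

(** The denominator 2 + tr P of q, multiplied by [w]. *)
Let J := (sconst 2 * w + g11 + g22)%SF.

Lemma J_gt0 x y : 0 < J x y.
Proof.
have w0 := area_gt0 x y; have a0 := g11_gt0 x y.
have c0 : 0 < g22 x y.
  apply: (Rmult_lt_reg_l (g11 x y)) => //.
  by have := area_sqr x y; have := Rle_0_sqr (g12 x y); rewrite /Rsqr; nra.
by rewrite /J saddE saddE smulE sconstE; lra.
Qed.

Let J_neq0 x y : J x y <> 0 := Rgt_not_eq _ _ (J_gt0 x y).

Let u := ((g22 - g11) * sinv J J_neq0)%SF.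
Let v := (sconst 2 * g12 * sinv J J_neq0)%SF.

Lemma uJ : (u * J)%SF = (g22 - g11)%SF.
Proof.
apply: sfun_eq => x y; rewrite /u !smulE Rmult_assoc.
by rewrite [sinv _ _ x y * _](Rinv_l _ (J_neq0 x y)) Rmult_1_r.
Qed.

Lemma vJ : (v * J)%SF = (sconst 2 * g12)%SF.
Proof.
apply: sfun_eq => x y; rewrite /v smulE [LHS]Rmult_assoc.
by rewrite [sinv _ _ x y * _](Rinv_l _ (J_neq0 x y)) Rmult_1_r.
Qed.

Lemma ww : (w * w)%SF = detg.
Proof. by apply: sfun_eq => x y; rewrite smulE area_sqr /detg !evE; ring. Qed.

Lemma dot_minimal z x y :
  g22 x y * dot eps z (fun k => Dx (Dx (f k)) x y) -
  2 * g12 x y * dot eps z (fun k => Dx (Dy (f k)) x y) +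
  g11 x y * dot eps z (fun k => Dy (Dy (f k)) x y) = 0.
Proof.
rewrite /Rminus -Ropp_mult_distr_l_reverse -!dotZr -!dotDr /dot big1 // => k _.
by rewrite -[RHS](Rmult_0_r (eps k * z k)) -(f_minimal k x y); ring.
Qed.

Lemma minimal_cr x y :
  (1 + u x y) * Dx u x y - v x y * Dy u x y -
    ((1 - u x y) * Dy v x y - v x y * Dx v x y) = 0 /\
  (1 - u x y) * Dy u x y - v x y * Dx u x y +
    ((1 + u x y) * Dx v x y - v x y * Dy v x y) = 0.
Proof.
pose P11 := dot eps (fun k => Dx (f k) x y) (fun k => Dx (Dx (f k)) x y).
pose P12 := dot eps (fun k => Dx (f k) x y) (fun k => Dx (Dy (f k)) x y).
pose P22 := dot eps (fun k => Dx (f k) x y) (fun k => Dy (Dy (f k)) x y).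
pose Q11 := dot eps (fun k => Dy (f k) x y) (fun k => Dx (Dx (f k)) x y).
pose Q12 := dot eps (fun k => Dy (f k) x y) (fun k => Dx (Dy (f k)) x y).
pose Q22 := dot eps (fun k => Dy (f k) x y) (fun k => Dy (Dy (f k)) x y).
have Ea1 : Dx g11 x y = 2 * P11.
  by rewrite /g11 DxD saddE DxC sconstE Dx_form dotC -/P11; ring.
have Ea2 : Dy g11 x y = 2 * P12.
  rewrite /g11 DyD saddE DyC sconstE Dy_form dotC.
  by under eq_dotr do rewrite DyDx; rewrite -/P12; ring.
have Eb1 : Dx g12 x y = Q11 + P12 by rewrite /g12 Dx_form dotC.
have Eb2 : Dy g12 x y = Q12 + P22.
  by rewrite /g12 Dy_form dotC; under eq_dotr do rewrite DyDx.
have Ec1 : Dx g22 x y = 2 * Q12.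
  by rewrite /g22 DxD saddE DxC sconstE Dx_form dotC -/Q12; ring.
have Ec2 : Dy g22 x y = 2 * Q22.
  by rewrite /g22 DyD saddE DyC sconstE Dy_form dotC -/Q22; ring.
have [Wx Ux Vx] := isothermal_derivation Dx DxD DxM DxC g11 g12 g22 w J u v x y
  ww (erefl _) uJ vJ.
have [Wy Uy Vy] := isothermal_derivation Dy DyD DyM DyC g11 g12 g22 w J u v x y
  ww (erefl _) uJ vJ.
move: Wx Ux Vx Wy Uy Vy; rewrite Ea1 Ea2 Eb1 Eb2 Ec1 Ec2 => Wx Ux Vx Wy Uy Vy.
have EU : u x y * J x y = g22 x y - g11 x y.
  have := congr1 (fun f : sfun => f x y) uJ.
  by rewrite smulE => ->; rewrite saddE smulE sconstE; ring.
have EV : v x y * J x y = 2 * g12 x y.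
  by have := congr1 (fun f : sfun => f x y) vJ; rewrite !smulE sconstE.
have JE : J x y = 2 * w x y + g11 x y + g22 x y.
  by rewrite /J saddE saddE smulE sconstE.
apply: (minimal_system_cr (g11 x y) (g12 x y) (g22 x y) (w x y) P11 P12 P22
  Q11 Q12 Q22 (J x y) (u x y) (v x y) (Dx w x y) (Dy w x y)) => //; try lra.
- exact: area_gt0.
- exact: J_gt0.
- exact: area_sqr.
- exact: dot_minimal.
- exact: dot_minimal.
Qed.

Lemma uv_lt1 x y : u x y * u x y + v x y * v x y < 1.
Proof.
have EU : u x y * J x y = g22 x y - g11 x y.
  have := congr1 (fun f : sfun => f x y) uJ.
  by rewrite smulE => ->; rewrite saddE smulE sconstE; ring.
have EV : v x y * J x y = 2 * g12 x y.
  by have := congr1 (fun f : sfun => f x y) vJ; rewrite !smulE sconstE.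
have JE : J x y = 2 * w x y + g11 x y + g22 x y.
  by rewrite /J saddE saddE smulE sconstE.
have [H _ _] := isothermal_identities _ _ _ _ _ _ _ (g11_gt0 x y) (area_gt0 x y)
  (J_gt0 x y) (area_sqr x y) JE EU EV.
exact: H.
Qed.

(** The terms in U and V beside the products of A and B come from the two Euclidean coordinates of
    the graph, whose frame derivatives are (1 + U, -V) and (-V, 1 - U). So the last three equations
    say that the parametrization is conformal. *)
Lemma minimal_isothermal : exists U V : R, U * U + V * V < 1 /\
  forall x y, let D1 := bel1 (sconst U) (sconst V) in
    let D2 := bel2 (sconst U) (sconst V) in
    let A k := D1 (f k) x y in let B k := D2 (f k) x y in
    let l := sqrt (detg x y) * (1 - U * U - V * V) in
    [/\ (forall k, D1 (D1 (f k)) x y + D2 (D2 (f k)) x y = 0),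
        dot eps A A + (1 + U) * (1 + U) + V * V = l,
        dot eps B B + (1 - U) * (1 - U) + V * V = l &
        dot eps A B = 2 * V].
Proof.
have [||Eu Ev] := beltrami_const u v uv_lt1.
- apply: sfun_eq => x y; have [H _] := minimal_cr x y; move: H.
  by rewrite bel1E bel2E; lra.
- apply: sfun_eq => x y; have [_ H] := minimal_cr x y; move: H.
  by rewrite bel2E smulE sconstE bel1E; lra.
have uE x y : u x y = u 0 0 by rewrite {1}Eu.
have vE x y : v x y = v 0 0 by rewrite {1}Ev.
exists (u 0 0), (v 0 0); split; first exact: uv_lt1.
move: (u 0 0) (v 0 0) uE vE => U V uE vE x y D1 D2 A B l.
have EU : U * J x y = g22 x y - g11 x y.
  have := congr1 (fun f : sfun => f x y) uJ.
  by rewrite smulE uE => ->; rewrite saddE smulE sconstE; ring.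
have EV : V * J x y = 2 * g12 x y.
  by have := congr1 (fun f : sfun => f x y) vJ; rewrite (smulE v) vE (smulE (sconst 2)) sconstE.
have JE : J x y = 2 * w x y + g11 x y + g22 x y.
  by rewrite /J saddE saddE smulE sconstE.
have [_ [I1 I2 I3] [H1 H2 H3]] := isothermal_identities _ _ _ _ _ _ _
  (g11_gt0 x y) (area_gt0 x y) (J_gt0 x y) (area_sqr x y) JE EU EV.
have lE : w x y * (1 - U * U - V * V) = l by [].
have E11 : g11 x y = 1 + dot eps (fun k => Dx (f k) x y) (fun k => Dx (f k) x y).
  by rewrite -formE.
have E22 : g22 x y = 1 + dot eps (fun k => Dy (f k) x y) (fun k => Dy (f k) x y).
  by rewrite -formE.
have E12 : g12 x y = dot eps (fun k => Dx (f k) x y) (fun k => Dy (f k) x y).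
  by rewrite -formE.
have AE k : A k = (1 + U) * Dx (f k) x y + - V * Dy (f k) x y.
  by rewrite /A /D1 bel1E !sconstE; ring.
have BE k : B k = (1 - U) * Dy (f k) x y + - V * Dx (f k) x y.
  by rewrite /B /D2 bel2E !sconstE; ring.
split.
- move=> k; rewrite /D1 /D2 /bel1 /bel2 !DE !DyDx !evE.
  transitivity (((1 + U) * (1 + U) + V * V) * Dx (Dx (f k)) x y -
    4 * V * Dx (Dy (f k)) x y + ((1 - U) * (1 - U) + V * V) * Dy (Dy (f k)) x y).
    by ring.
  by rewrite H1 H2 H3 -[RHS](Rmult_0_r (4 / J x y)) -(f_minimal k x y); ring.
- rewrite (eq_dotr _ _ _ _ AE) dotC (eq_dotr _ _ _ _ AE) !(dotDl, dotZl, dotDr, dotZr).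
  move: I1; rewrite lE E11 E22 E12 => <-.
  by rewrite (dotC _ (fun k => Dy (f k) x y) (fun k => Dx (f k) x y)); ring.
- rewrite (eq_dotr _ _ _ _ BE) dotC (eq_dotr _ _ _ _ BE) !(dotDl, dotZl, dotDr, dotZr).
  move: I2; rewrite lE E11 E22 E12 => <-.
  by rewrite (dotC _ (fun k => Dy (f k) x y) (fun k => Dx (f k) x y)); ring.
- rewrite (eq_dotr _ _ _ _ BE) dotC (eq_dotr _ _ _ _ AE) !(dotDl, dotZl, dotDr, dotZr).
  move: I3; rewrite E11 E22 E12.
  rewrite (dotC _ (fun k => Dy (f k) x y) (fun k => Dx (f k) x y)); lra.
Qed.

End MinimalSystem.

(** * Entire lightlike gradients *)

Lemma continuous2_pos f x y : continuous2 f -> 0 < f x y ->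
  exists2 d, 0 < d &
    forall u v, Rabs (u - x) < d -> Rabs (v - y) < d -> 0 < f u v.
Proof.
move=> fc f0; have [d Hd] := fc x y (mkposreal _ f0).
exists d; first exact: cond_pos.
move=> u v Hu Hv; have /Rabs_lt_between H := Hd u v Hu Hv.
have {H} [H _] : - f x y < f u v - f x y < f x y := H.
lra.
Qed.

Lemma holo_comb fr p r p' r' c : holo fr p r -> holo fr p' r' ->
  holo fr (p - sconst c * p')%SF (r - sconst c * r')%SF.
Proof.
move=> [H1 H2] [H1' H2'].
split; rewrite !(d1D, d1M, d1C, d2D, d2M, d2C) ?H1 ?H1' ?H2 ?H2';
  by apply: sfun_eq => x y; rewrite !evE; ring.
Qed.

(** * Quotients of holomorphic functions *)

Section Quotient.

Variables (fr : frame) (p1 r1 p2 r2 : sfun).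
Hypothesis pr1 : holo fr p1 r1.
Hypothesis pr2 : holo fr p2 r2.

Lemma holo_quotient (P Q : sfun) :
  (forall x y, p2 x y * p2 x y + r2 x y * r2 x y <> 0) ->
  p1 = (P * p2 - Q * r2)%SF -> r1 = (P * r2 + Q * p2)%SF -> holo fr P Q.
Proof.
move=> N0 Ep Er.
(* E and F are the real and imaginary parts of (D1 + i D2)(P + i Q) times p2 + i r2, which vanishes
   by the Leibniz rule. *)
have E x y : (d1 fr P x y - d2 fr Q x y) * p2 x y -
    (d2 fr P x y + d1 fr Q x y) * r2 x y = 0.
  have := congr1 (fun f : sfun => f x y) (proj1 pr1).
  rewrite Ep Er !(d1D, d2D, d1M, d2M, d1C) (holo_d1r _ _ _ pr2) -(proj1 pr2).
  by rewrite !evE; lra.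
have F x y : (d2 fr P x y + d1 fr Q x y) * p2 x y +
    (d1 fr P x y - d2 fr Q x y) * r2 x y = 0.
  have := congr1 (fun f : sfun => f x y) (proj2 pr1).
  rewrite Ep Er !(d1D, d2D, d1M, d2M, d2C) (holo_d1r _ _ _ pr2) -(proj1 pr2).
  by rewrite !evE; lra.
split; apply: sfun_eq => x y; rewrite ?smulE ?sconstE;
  apply: Rminus_diag_uniq; apply: (Rmult_eq_reg_l _ _ _ _ (N0 x y));
  rewrite Rmult_0_r.
  transitivity (p2 x y * ((d1 fr P x y - d2 fr Q x y) * p2 x y -
      (d2 fr P x y + d1 fr Q x y) * r2 x y) +
    r2 x y * ((d2 fr P x y + d1 fr Q x y) * p2 x y +
      (d1 fr P x y - d2 fr Q x y) * r2 x y)); first ring.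
  by rewrite E F; ring.
transitivity (p2 x y * ((d2 fr P x y + d1 fr Q x y) * p2 x y +
      (d1 fr P x y - d2 fr Q x y) * r2 x y) -
    r2 x y * ((d1 fr P x y - d2 fr Q x y) * p2 x y -
      (d2 fr P x y + d1 fr Q x y) * r2 x y)); first ring.
by rewrite E F; ring.
Qed.

Lemma holo_proportional :
  (forall x y, p2 x y * p2 x y + r2 x y * r2 x y <> 0) ->
  (forall x y, p1 x y * p1 x y + r1 x y * r1 x y <=
     p2 x y * p2 x y + r2 x y * r2 x y) ->
  exists P Q, forall x y, p1 x y = P * p2 x y - Q * r2 x y /\
    r1 x y = P * r2 x y + Q * p2 x y.
Proof.
move=> N0 le12.
have N0' x y : (p2 * p2 + r2 * r2)%SF x y <> 0 by rewrite !evE.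
pose I := sinv _ N0'.
have IE x y : I x y * (p2 x y * p2 x y + r2 x y * r2 x y) = 1.
  exact: (Rinv_l _ (N0 x y)).
pose P := ((p1 * p2 + r1 * r2) * I)%SF.
pose Q := ((r1 * p2 - p1 * r2) * I)%SF.
have Ep : p1 = (P * p2 - Q * r2)%SF.
  apply: sfun_eq => x y; transitivity (p1 x y * 1); first ring.
  by rewrite -(IE x y) /P /Q !(saddE, smulE, sconstE); ring.
have Er : r1 = (P * r2 + Q * p2)%SF.
  apply: sfun_eq => x y; transitivity (r1 x y * 1); first ring.
  by rewrite -(IE x y) /P /Q !(saddE, smulE, sconstE); ring.
clearbody P Q; have PQ := holo_quotient P Q N0 Ep Er.
have PQ1 x y : P x y * P x y + Q x y * Q x y <= 1.
  have Ep' : p1 x y = P x y * p2 x y - Q x y * r2 x y.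
    by rewrite {1}Ep !evE; ring.
  have Er' : r1 x y = P x y * r2 x y + Q x y * p2 x y.
    by rewrite {1}Er !evE.
  have Np : 0 < p2 x y * p2 x y + r2 x y * r2 x y.
    by have := N0 x y; have := Rle_0_sqr (p2 x y); have := Rle_0_sqr (r2 x y);
      rewrite /Rsqr; lra.
  apply: (Rmult_le_reg_r _ _ _ Np); rewrite Rmult_1_l.
  apply: Rle_trans (le12 x y); rewrite Ep' Er'; apply: Req_le; ring.
have [P1 P2] := holo_liouville fr P Q 1 PQ PQ1.
have Q2 : d2 fr Q = sconst 0 by rewrite -(proj1 PQ).
have Q1 : d1 fr Q = sconst 0.
  by rewrite (holo_d1r _ _ _ PQ) P2; apply: sfun_eq => x y; rewrite !evE; ring.
have PE := frame_const fr P P1 P2; have QE := frame_const fr Q Q1 Q2.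
exists (P 0 0), (Q 0 0) => x y; split.
  by rewrite Ep !evE {1}PE {1}QE !sconstE; ring.
by rewrite Er !evE {1}PE {1}QE !sconstE.
Qed.

End Quotient.

(** * Gradients in Lorentz signature *)

Section Lorentz.

Context {n : nat} (eps : 'I_n -> R) (t : 'I_n).
Hypothesis eps_t : eps t = -1.
Hypothesis eps_s : forall k : 'I_n, k != t -> eps k = 1.

Lemma dot_lorentz (x y : 'I_n -> R) : dot eps x y =
  \big[Rplus/0]_(k < n | k != t) (x k * y k) - x t * y t.
Proof.
rewrite /dot (bigD1 t) //= eps_t (eq_bigr (fun k => x k * y k)).
  by set S := \big[_/_]_(_ | _) _; change (-1 * (x t * y t) + S = S - x t * y t); ring.
by move=> k /eps_s ->; ring.
Qed.

Lemma sum_sqr_ge0 (P : pred 'I_n) x : 0 <= \big[Rplus/0]_(k < n | P k) (x k * x k).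
Proof.
elim/big_ind: _ => [|a b a0 b0|k _]; [exact: Rle_refl | exact: Rplus_le_le_0_compat|].
by have := Rle_0_sqr (x k).
Qed.

Lemma dot_sqr_ge (k : 'I_n) (x : 'I_n -> R) : k != t -> x k * x k <= dot eps x x + x t * x t.
Proof.
move=> kt; rewrite dot_lorentz (bigD1 k) //=.
have := sum_sqr_ge0 (fun i => (i != t) && (i != k)) x.
by move: (\big[_/_]_(_ < n | _) _) => S S0; lra.
Qed.

Lemma dot_time_ge0 (x : 'I_n -> R) : 0 <= dot eps x x + x t * x t.
Proof.
by rewrite dot_lorentz; have := sum_sqr_ge0 (fun k => k != t) x; lra.
Qed.

Lemma dot_ge0 (x : 'I_n -> R) : x t = 0 -> 0 <= dot eps x x.
Proof.
move=> xt; rewrite dot_lorentz xt.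
by have := sum_sqr_ge0 (fun k => k != t) x; lra.
Qed.

(** * Constant frames and the case q <> 0 *)

Section Endgame.

Variables (fr : frame) (f : 'I_n -> sfun) (W : R -> R -> R) (U V : R).

Local Notation D1 := (d1 fr).
Local Notation D2 := (d2 fr).

Hypothesis UV1 : U * U + V * V < 1.
Hypothesis D1E : forall g x y, D1 g x y = (1 + U) * Dx g x y - V * Dy g x y.
Hypothesis D2E : forall g x y, D2 g x y = (1 - U) * Dy g x y - V * Dx g x y.
Hypothesis f_harmonic : forall k x y, D1 (D1 (f k)) x y + D2 (D2 (f k)) x y = 0.
Hypothesis f_conformal : forall x y,
  let A k := D1 (f k) x y in let B k := D2 (f k) x y in
  let l := W x y * (1 - U * U - V * V) in
  [/\ dot eps A A + (1 + U) * (1 + U) + V * V = l,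
      dot eps B B + (1 - U) * (1 - U) + V * V = l &
      dot eps A B = 2 * V].
Hypothesis W_le1 : forall x y, W x y <= 1.

(** For phi_k = D1 f_k - i D2 f_k, one Cauchy-Riemann equation is harmonicity and the other is
    commutation of the frame. *)
Lemma gradient_holo k : holo fr (D1 (f k)) (- D2 (f k))%SF.
Proof.
split.
  rewrite d2M d2C; apply: sfun_eq => x y; rewrite !evE.
  by have := f_harmonic k x y; lra.
by rewrite d1M d1C d2d1; apply: sfun_eq => x y; rewrite !evE; ring.
Qed.

Lemma frame_inverse g x y :
  (1 - U * U - V * V) * Dx g x y = (1 - U) * D1 g x y + V * D2 g x y /\
  (1 - U * U - V * V) * Dy g x y = V * D1 g x y + (1 + U) * D2 g x y.
Proof. by rewrite D1E D2E; split; ring. Qed.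

Lemma affine_of_const_gradient g a b :
  (forall x y, D1 g x y = a) -> (forall x y, D2 g x y = b) ->
  exists p q, forall x y, g x y = p * x + q * y + g 0 0.
Proof.
move=> Ha Hb; pose e := 1 - U * U - V * V; have e0 : e <> 0 by rewrite /e; lra.
pose p := ((1 - U) * a + V * b) / e; pose q := (V * a + (1 + U) * b) / e.
exists p, q => x y.
pose h := (g - (sconst p * sX + sconst q * sY))%SF.
have gx z s : Dx g z s = p.
  have [H _] := frame_inverse g z s; rewrite Ha Hb in H.
  by rewrite /p -H -/e; field.
have gy z s : Dy g z s = q.
  have [_ H] := frame_inverse g z s; rewrite Ha Hb in H.
  by rewrite /q -H -/e; field.
have hE : h = sconst (h 0 0).
  apply: sfun_const; apply: sfun_eq => z s; rewrite /h.
    by rewrite DxD !saddE gx !(DxM, DxD, DxC, DxX, DxY) !evE; ring.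
  by rewrite DyD !saddE gy !(DyM, DyD, DyC, DyX, DyY) !evE; ring.
have := congr1 (fun f : sfun => f x y) hE; rewrite /h !evE; lra.
Qed.

(** The sum of the two length equations and W <= 1 give <A, A> + <B, B> <= -4 (U^2 + V^2); the other
    spatial squares are dropped. *)
Lemma gradient_norm_le (k : 'I_n) x y : k != t ->
  D1 (f k) x y * D1 (f k) x y + D2 (f k) x y * D2 (f k) x y +
    4 * (U * U + V * V) <=
  D1 (f t) x y * D1 (f t) x y + D2 (f t) x y * D2 (f t) x y.
Proof.
move=> kt; have [HA HB _] := f_conformal x y.
have := dot_sqr_ge k (fun k => D1 (f k) x y) kt.
have := dot_sqr_ge k (fun k => D2 (f k) x y) kt.
have e0 : 0 < 1 - U * U - V * V by lra.
have := Rmult_le_compat_r _ _ _ (Rlt_le _ _ e0) (W_le1 x y).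
by cbv beta; lra.
Qed.

Lemma time_gradient_ge x y : 4 * (U * U + V * V) <=
  D1 (f t) x y * D1 (f t) x y + D2 (f t) x y * D2 (f t) x y.
Proof.
have [HA HB _] := f_conformal x y.
have := dot_time_ge0 (fun k => D1 (f k) x y).
have := dot_time_ge0 (fun k => D2 (f k) x y).
have e0 : 0 < 1 - U * U - V * V by lra.
have := Rmult_le_compat_r _ _ _ (Rlt_le _ _ e0) (W_le1 x y).
by cbv beta; lra.
Qed.

Lemma entire_affine : 0 < U * U + V * V ->
  forall k, exists p q, forall x y, f k x y = p * x + q * y + f k 0 0.
Proof.
move=> q0.
pose N x y := D1 (f t) x y * D1 (f t) x y + D2 (f t) x y * D2 (f t) x y.
have N0 x y : 0 < N x y by have := time_gradient_ge x y; rewrite -/(N x y); lra.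
have /functional_choice[PQ PQE] k : exists PQ : R * R, forall x y,
    D1 (f k) x y = PQ.1 * D1 (f t) x y + PQ.2 * D2 (f t) x y /\
    D2 (f k) x y = PQ.1 * D2 (f t) x y - PQ.2 * D1 (f t) x y.
  have [||P [Q H]] := holo_proportional fr _ _ _ _ (gradient_holo k) (gradient_holo t).
  - by move=> x y; rewrite !evE; have := N0 x y; rewrite /N; lra.
  - move=> x y; rewrite !evE; case: (eqVneq k t) => [->|kt]; first by lra.
    by have := gradient_norm_le k x y kt; lra.
  by exists (P, Q) => x y; have := H x y; rewrite !evE /=; lra.
(* C1 + i C2 is <c, c> for the complex vector c = P + i Q of ratios, so <phi, phi> = (C1 + i C2)
   phi_t^2. By conformality <phi, phi> = -4 (U + i V), and [CN] compares squared moduli. *)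
pose C1 := dot eps (fun k => (PQ k).1) (fun k => (PQ k).1) -
  dot eps (fun k => (PQ k).2) (fun k => (PQ k).2).
pose C2 := 2 * dot eps (fun k => (PQ k).1) (fun k => (PQ k).2).
have CN x y : (C1 * C1 + C2 * C2) * (N x y * N x y) = 16 * (U * U + V * V).
  have [HA HB HAB] := f_conformal x y.
  move: HA HB HAB; cbv beta zeta.
  have -> : (fun k => D1 (f k) x y) =
      fun k => D1 (f t) x y * (PQ k).1 + D2 (f t) x y * (PQ k).2.
    by apply: functional_extensionality => k; have [-> _] := PQE k x y; ring.
  have -> : (fun k => D2 (f k) x y) =
      fun k => D2 (f t) x y * (PQ k).1 + - D1 (f t) x y * (PQ k).2.
    by apply: functional_extensionality => k; have [_ ->] := PQE k x y; ring.
  rewrite !(dotDl, dotDr, dotZl, dotZr) (dotC _ (fun k => (PQ k).2) (fun k => (PQ k).1)).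
  rewrite /N /C1 /C2.
  move: (D1 (f t) x y) (D2 (f t) x y) (W x y * _) => a b l.
  move: (dot _ _ _) (dot _ _ _) (dot _ _ _) => c11 c12 c22 H1 H2 H3.
  transitivity (Rsqr ((a * a - b * b) * (c22 - c11) + 4 * (a * b) * c12) +
    Rsqr (2 * (a * b) * (c22 - c11) - 2 * (a * a - b * b) * c12)).
    by rewrite /Rsqr; ring.
  have -> : (a * a - b * b) * (c22 - c11) + 4 * (a * b) * c12 = - 4 * U by lra.
  have -> : 2 * (a * b) * (c22 - c11) - 2 * (a * a - b * b) * c12 = 4 * V by lra.
  by rewrite /Rsqr; ring.
have C0 : 0 < C1 * C1 + C2 * C2.
  apply: (Rmult_lt_reg_r (N 0 0 * N 0 0)); first by have := N0 0 0; nra.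
  by rewrite CN Rmult_0_l; lra.
(* N^2 is constant, and N <= 1 + N^2 bounds N without a square root. *)
have Nle x y : N x y <= 1 + 16 * (U * U + V * V) / (C1 * C1 + C2 * C2).
  rewrite -(CN x y) (_ : _ / _ = N x y * N x y); last by field; lra.
  by have := Rle_0_sqr (N x y - 1); have := N0 x y; rewrite /Rsqr; lra.
have [|A1 A2] := holo_liouville fr _ _
  (1 + 16 * (U * U + V * V) / (C1 * C1 + C2 * C2)) (gradient_holo t).
  by move=> x y; have := Nle x y; rewrite /N !evE; lra.
have At := frame_const fr _ A1 A2.
have Bt : D2 (f t) = sconst (D2 (f t) 0 0).
  apply: (frame_const fr); first by rewrite -d2d1.
  apply: sfun_eq => x y; have := f_harmonic t x y.
  by rewrite A1 !evE; lra.
move=> k; apply: (affine_of_const_gradient (f k)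
  ((PQ k).1 * D1 (f t) 0 0 + (PQ k).2 * D2 (f t) 0 0)
  ((PQ k).1 * D2 (f t) 0 0 - (PQ k).2 * D1 (f t) 0 0)) => x y.
  by have [-> _] := PQE k x y; rewrite {1}At {1}Bt.
by have [_ ->] := PQE k x y; rewrite {1}At {1}Bt.
Qed.

End Endgame.

(** * The case q = 0 *)

Section NullCase.

Variables (f : 'I_n -> sfun) (W : R -> R -> R).
Hypothesis f_harmonic : forall k x y, Dx (Dx (f k)) x y + Dy (Dy (f k)) x y = 0.
Hypothesis f_conformal : forall x y,
  let A k := Dx (f k) x y in let B k := Dy (f k) x y in
  [/\ dot eps A A + 1 = W x y, dot eps B B + 1 = W x y & dot eps A B = 0].
Hypothesis W_le1 : forall x y, W x y <= 1.

Let N x y := Dx (f t) x y * Dx (f t) x y + Dy (f t) x y * Dy (f t) x y.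

(* With [A] and [B] the two partial derivatives of [f], the vector
   [B t * A - A t * B] has no [t] component, so its square is nonnegative; but
   this square is [(W - 1) * N]. *)
Lemma null_wedge x y :
  (forall k, Dx (f k) x y * Dy (f t) x y = Dy (f k) x y * Dx (f t) x y) /\
  (W x y - 1) * N x y = 0.
Proof.
have [HA HB HAB] := f_conformal x y; move: HA HB HAB; cbv beta zeta.
move=> HA HB HAB; set a := Dx (f t) x y; set b := Dy (f t) x y.
pose z k := b * Dx (f k) x y + - a * Dy (f k) x y.
have zt : z t = 0 by rewrite /z -/a -/b; ring.
have zz : dot eps z z = (W x y - 1) * N x y.
  rewrite /z !(dotDl, dotDr, dotZl, dotZr) (dotC _ (fun k => Dy _ _ _)) HAB.
  have -> : dot eps (fun k => Dx (f k) x y) (fun k => Dx (f k) x y) = W x y - 1 by lra.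
  have -> : dot eps (fun k => Dy (f k) x y) (fun k => Dy (f k) x y) = W x y - 1 by lra.
  by rewrite /N -/a -/b; ring.
have z0 := dot_ge0 _ zt.
have N0 : 0 <= N x y.
  have := Rle_0_sqr a; have := Rle_0_sqr b; rewrite /N -/a -/b /Rsqr; lra.
have z1 : (W x y - 1) * N x y = 0.
  apply: Rle_antisym; last by rewrite -zz.
  by have := Rmult_le_compat_r _ _ _ N0 (W_le1 x y); lra.
split=> // k; case: (eqVneq k t) => [->|kt]; first by rewrite -/a -/b; ring.
have := dot_sqr_ge k z kt; rewrite zz z1 zt => Hz.
have : z k = 0 by have := Rle_0_sqr (z k); rewrite /Rsqr; nra.
by rewrite /z; lra.
Qed.

(** Where N vanishes, the x-derivative of f has no time component, so W = 1 + <A, A> >= 1. *)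
Lemma null_area x y : W x y = 1.
Proof.
have [_ /Rmult_integral[]] := null_wedge x y; first by lra.
have [HA _ _] := f_conformal x y; move: HA; cbv beta zeta => HA N0.
have a0 : Dx (f t) x y = 0 by move: N0; rewrite /N; nra.
apply: Rle_antisym => //; rewrite -HA.
have := dot_ge0 (fun k => Dx (f k) x y) a0; lra.
Qed.

Lemma null_holo k : holo std_frame (Dx (f k)) (- Dy (f k))%SF.
Proof.
rewrite /holo !std_d1 !std_d2 DxM DyM DxC DyC DyDx.
split; apply: sfun_eq => x y; rewrite !evE; last by ring.
by have := f_harmonic k x y; lra.
Qed.

(** P / M is phi_k / phi_t, which is real by [null_wedge]; a real holomorphic function has zero
    derivative. *)
Lemma null_ratio_derivative k x y : 0 < N x y ->
  let P := (Dx (f k) * Dx (f t) + Dy (f k) * Dy (f t))%SF in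
  let M := (Dx (f t) * Dx (f t) + Dy (f t) * Dy (f t))%SF in
  Dx P x y * M x y = P x y * Dx M x y /\ Dy P x y * M x y = P x y * Dy M x y.
Proof.
move=> N0 P M.
have wedge : (Dx (f k) * Dy (f t))%SF = (Dy (f k) * Dx (f t))%SF.
  by apply: sfun_eq => z s; rewrite !smulE; have [H _] := null_wedge z s.
have H1 := congr1 (fun g : sfun => Dx g x y) wedge.
have H2 := congr1 (fun g : sfun => Dy g x y) wedge.
have H0 := congr1 (fun g : sfun => g x y) wedge.
have hk := f_harmonic k x y; have ht := f_harmonic t x y.
move: H0 H1 H2 N0; rewrite /P /M /N !DE !DyDx !evE.
have -> : Dy (Dy (f k)) x y = - Dx (Dx (f k)) x y by lra.
have -> : Dy (Dy (f t)) x y = - Dx (Dx (f t)) x y by lra.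
move: (Dx (f k) x y) (Dy (f k) x y) (Dx (f t) x y) (Dy (f t) x y)
  (Dx (Dx (f k)) x y) (Dx (Dx (f t)) x y) (Dx (Dy (f k)) x y) (Dx (Dy (f t)) x y).
move=> A B a b A1 a1 A2 a2 H0 H1 H2 N0.
pose c := (A * a + B * b) / (a * a + b * b).
have EA : A = c * a.
  rewrite /c; apply: (Rmult_eq_reg_r (a * a + b * b)); last by lra.
  transitivity (a * (A * a) + b * (A * b)); first by ring.
  by rewrite H0; field; lra.
have EB : B = c * b.
  rewrite /c; apply: (Rmult_eq_reg_r (a * a + b * b)); last by lra.
  transitivity (a * (B * a) + b * (B * b)); first by ring.
  by rewrite -H0; field; lra.
move: H1 H2; rewrite EA EB => H1 H2.
have E1 : A1 * a + A2 * b = c * (a * a1 + b * a2) by lra.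
have E2 : A2 * a - A1 * b = c * (a * a2 - b * a1) by lra.
split.
  transitivity ((A1 * a + A2 * b + c * (a * a1 + b * a2)) * (a * a + b * b)); first by ring.
  by rewrite E1; ring.
transitivity ((A2 * a - A1 * b + c * (a * a2 - b * a1)) * (a * a + b * b)); first by ring.
by rewrite E2; ring.
Qed.

Lemma null_ratio k a b d : 0 < d ->
  (forall x y, Rabs (x - a) < d -> Rabs (y - b) < d -> 0 < N x y) ->
  exists c, forall x y, Rabs (x - a) < d -> Rabs (y - b) < d ->
    Dx (f k) x y = c * Dx (f t) x y /\ Dy (f k) x y = c * Dy (f t) x y.
Proof.
move=> d0 Npos.
pose P := (Dx (f k) * Dx (f t) + Dy (f k) * Dy (f t))%SF.
pose M := (Dx (f t) * Dx (f t) + Dy (f t) * Dy (f t))%SF.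
exists (P a b / M a b) => x y Hx Hy.
have seg s z z0 : 0 <= s <= 1 -> Rabs (z - z0) < d -> Rabs (z0 + s * (z - z0) - z0) < d.
  move=> s01 Hz; rewrite (_ : z0 + s * (z - z0) - z0 = s * (z - z0)); last by ring.
  rewrite Rabs_mult (Rabs_pos_eq s); last by lra.
  have := Rmult_le_compat_r _ _ _ (Rabs_pos (z - z0)) (proj2 s01); lra.
pose px s := a + s * (x - a); pose py s := b + s * (y - b).
have Mpos s : 0 <= s <= 1 -> 0 < M (px s) (py s).
  by move=> s01; apply: Npos; apply: seg.
have ratio : P x y / M x y = P a b / M a b.
  (* The square is convex, so the ratio can be followed along the segment from its centre. *)
  have [|z [E _]] := MVT_cor2 (fun s => P (px s) (py s) / M (px s) (py s))
    (fun=> 0) 0 1 Rlt_0_1.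
    move=> s s01; apply/is_derive_Reals.
    have HM := Mpos s s01.
    have [R1 R2] := null_ratio_derivative k (px s) (py s) HM; rewrite -/P -/M in R1 R2.
    have := is_derive_div _ _ _ _ _ (sfun_derive_line P a b (x - a) (y - b) s)
      (sfun_derive_line M a b (x - a) (y - b) s) (Rgt_not_eq _ _ HM).
    rewrite -/(px s) -/(py s) (_ : _ / _ ^ 2 = 0) // /Rdiv.
    rewrite (_ : _ - _ =
      (x - a) * (Dx P (px s) (py s) * M (px s) (py s) - P (px s) (py s) * Dx M (px s) (py s)) +
      (y - b) * (Dy P (px s) (py s) * M (px s) (py s) - P (px s) (py s) * Dy M (px s) (py s)));
      last by ring.
    by rewrite R1 R2; ring.
  have E1 : px 1 = x by rewrite /px; ring.
  have E2 : py 1 = y by rewrite /py; ring.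
  have E3 : px 0 = a by rewrite /px; ring.
  have E4 : py 0 = b by rewrite /py; ring.
  by move: E; rewrite E1 E2 E3 E4; lra.
have Mxy : 0 < M x y by apply: Npos.
have [/(_ k) H _] := null_wedge x y.
have PE : P x y = P a b / M a b * M x y by rewrite -ratio; field; lra.
move: (P a b / M a b) PE Mxy => c; rewrite /P /M !(saddE, smulE) => PE Mxy.
move: H PE Mxy.
move: (Dx (f k) x y) (Dy (f k) x y) (Dx (f t) x y) (Dy (f t) x y) => A B u v H PE Mxy.
split; apply: (Rmult_eq_reg_r (u * u + v * v)); try lra.
  transitivity (u * (A * u) + v * (A * v)); first by ring.
  rewrite H; transitivity (u * (A * u + B * v)); first by ring.
  by rewrite PE; ring.
transitivity (u * (B * u) + v * (B * v)); first by ring.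
rewrite -H; transitivity (v * (A * u + B * v)); first by ring.
by rewrite PE; ring.
Qed.

(** Unless N vanishes identically, the ratios are constants c_k near some point. The entire
    functions phi_k - c_k phi_t vanish there, hence everywhere, and zeros of phi_t do no harm. *)
Lemma null_entire :
  (forall k, exists p q, forall x y, f k x y = p * x + q * y + f k 0 0) \/
  exists c, [/\ c t = 1, dot eps c c = 0 &
    forall k x y, f k x y = c k * f t x y + (f k 0 0 - c k * f t 0 0)].
Proof.
case: (classic (exists z, N z.1 z.2 <> 0)) => [[[a b] /= Nab]|HN]; last first.
  left=> k; exists 0, 0 => x y.
  have N0 z s : N z s = 0.
    by apply: NNPP => H; apply: HN; exists (z, s).
  have D0 z s : Dx (f k) z s = 0 /\ Dy (f k) z s = 0.
    have [HA HB _] := f_conformal z s; move: HA HB (N0 z s); cbv beta zeta.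
    rewrite null_area /N => HA HB Nzs.
    have a0 : Dx (f t) z s = 0 by nra.
    have b0 : Dy (f t) z s = 0 by nra.
    case: (eqVneq k t) => [->|kt]; first by [].
    have := dot_sqr_ge k (fun k => Dx (f k) z s) kt.
    have := dot_sqr_ge k (fun k => Dy (f k) z s) kt.
    by rewrite a0 b0 => H1 H2; split; nra.
  have E : f k = sconst (f k 0 0).
    by apply: sfun_const; apply: sfun_eq => z s; have [] := D0 z s.
  by rewrite E !sconstE; ring.
right.
pose M := (Dx (f t) * Dx (f t) + Dy (f t) * Dy (f t))%SF.
have Mab : 0 < M a b.
  have := Rle_0_sqr (Dx (f t) a b); have := Rle_0_sqr (Dy (f t) a b).
  by move: Nab; rewrite /N /M /Rsqr !(saddE, smulE); lra.
have [d d0 Md] := continuous2_pos M a b (sfun_continuous2 M) Mab.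
have /functional_choice[c cE] k := null_ratio k a b d d0 Md.
have propor k x y :
    Dx (f k) x y = c k * Dx (f t) x y /\ Dy (f k) x y = c k * Dy (f t) x y.
  (* [holo_unique_continuation] expects a squared radius; this disk lies in the square where the
     ratios are known. *)
  have dd : 0 < d * d by apply: Rmult_lt_0_compat.
  have [|p0 q0] := holo_unique_continuation a b (d * d) dd _ _
    (holo_comb _ _ _ _ _ (c k) (null_holo k) (null_holo t)) _ x y.
    move=> z s; rewrite dist2E => Hd.
    have lt_d w : w * w < d * d -> Rabs w < d.
      by move=> H; rewrite -(Rabs_pos_eq d); [apply: Rsqr_lt_abs_0 | lra].
    have Hz : Rabs (z - a) < d.
      by apply: lt_d; have := Rle_0_sqr (s - b); rewrite /Rsqr; lra.
    have Hs : Rabs (s - b) < d.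
      by apply: lt_d; have := Rle_0_sqr (z - a); rewrite /Rsqr; lra.
    by have [E1 E2] := cE k z s Hz Hs; rewrite !evE E1 E2; split; ring.
  by move: p0 q0; rewrite !evE; lra.
exists c; split.
- have [E1 E2] := propor t a b.
  apply: (Rmult_eq_reg_r (M a b)); last by lra.
  rewrite /M !(saddE, smulE).
  transitivity (c t * Dx (f t) a b * Dx (f t) a b + c t * Dy (f t) a b * Dy (f t) a b);
    first by ring.
  by rewrite -E1 -E2; ring.
- have [HA HB _] := f_conformal a b; move: HA HB; cbv beta zeta; rewrite null_area.
  have -> : (fun k => Dx (f k) a b) = fun k => Dx (f t) a b * c k.
    by apply: functional_extensionality => k; have [-> _] := propor k a b; ring.
  have -> : (fun k => Dy (f k) a b) = fun k => Dy (f t) a b * c k.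
    by apply: functional_extensionality => k; have [_ ->] := propor k a b; ring.
  rewrite !(dotZl, dotZr) => HA HB.
  apply: (Rmult_eq_reg_r (M a b)); last by lra.
  by rewrite /M !(saddE, smulE); lra.
- move=> k x y.
  have E : (f k - sconst (c k) * f t)%SF = sconst ((f k - sconst (c k) * f t)%SF 0 0).
    apply: sfun_const; apply: sfun_eq => z s; have [E1 E2] := propor k z s.
      by rewrite !(DxD, DxM, DxC) !evE E1; ring.
    by rewrite !(DyD, DyM, DyC) !evE E2; ring.
  by have := congr1 (fun g : sfun => g x y) E; rewrite !evE; lra.
Qed.

End NullCase.

End Lorentz.

(** * Stationary graphs in Minkowski space *)

(* Required only here, because it shadows the tactic [ring] of Stdlib. *)
From mathcomp Require Import ring.
Local Open Scope ring_scope.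

Section GraphGeometry.

Variables (m : nat) (f : R -> R -> 'rV[R]_m).
Hypothesis m_gt0 : (0 < m)%N.
Hypothesis f_smooth : smooth f.

Definition component (k : 'I_m) : sfun :=
  SFun (fun s t => f s t 0 k) (f_smooth k).

Definition signature (k : 'I_m) : R := (-1) ^+ (k.+1 == m).

Lemma minkowski_dot (u v : 'rV[R]_m) :
  minkowski u v = dot signature (u 0) (v 0).
Proof. by []. Qed.

Lemma minkowski_row_mx (a b : 'rV[R]_2) (u v : 'rV[R]_m) :
  minkowski (row_mx a u) (row_mx b v) =
  a 0 0 * b 0 0 + a 0 1 * b 0 1 + minkowski u v.
Proof.
rewrite /minkowski big_split_ord /=; congr (_ + _).
  (* As 0 < m, neither Euclidean coordinate is the last one, so both get the sign +1. *)
  have s1 (i : 'I_2) : (i.+1 == 2 + m)%N = false.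
    by apply/eqP => E; case: i E => -[|[|]] //= _ /eqP; case: (m) m_gt0.
  rewrite !big_ord_recl big_ord0 addr0 !row_mxEl !s1 !mul1r.
  by congr (_ * _ + _ * _); congr (_ 0 _); apply: val_inj.
by apply: eq_bigr => k _; rewrite !row_mxEr.
Qed.

Lemma vpderiv_graph i x y : vpderiv i (graph_param f) x y =
  row_mx (delta_mx 0 i) (\row_k pderiv i (component k) x y).
Proof.
apply/rowP => k; rewrite mxE -[k]splitK; case: (split k) => j /=.
  rewrite row_mxEl mxE eqxx /= eq_sym.
  transitivity (pderiv i (fun s t => if j == 0 then s else t) x y).
    by congr (pderiv i _ x y); apply: functional_extensionality => s;
      apply: functional_extensionality => t; rewrite /graph_param row_mxEl mxE.
  rewrite /pderiv; case: i j => -[|[|]] // hi [[|[|]] // hj] /=;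
    by rewrite ?Derive_id ?Derive_const.
rewrite row_mxEr mxE; congr (pderiv i _ x y).
by apply: functional_extensionality => s; apply: functional_extensionality => t;
  rewrite /graph_param row_mxEr.
Qed.

Lemma vpderiv2_graph i j x y : vpderiv i (vpderiv j (graph_param f)) x y =
  row_mx 0 (\row_k pderiv i (pderiv j (component k)) x y).
Proof.
apply/rowP => k; rewrite mxE -[k]splitK; case: (split k) => l /=.
  rewrite row_mxEl mxE.
  transitivity (pderiv i (fun _ _ => (delta_mx 0 j : 'rV[R]_2) 0 l) x y).
    by congr (pderiv i _ x y); apply: functional_extensionality => s;
      apply: functional_extensionality => t; rewrite vpderiv_graph row_mxEl.
  by rewrite /pderiv; case: ifP => _; rewrite Derive_const.
rewrite row_mxEr mxE; congr (pderiv i _ x y).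
by apply: functional_extensionality => s; apply: functional_extensionality => t;
  rewrite vpderiv_graph row_mxEr mxE.
Qed.

Lemma metric_graph i j x y : metric (graph_param f) x y i j =
  (i == j)%:R + dot signature (fun k => pderiv i (component k) x y)
    (fun k => pderiv j (component k) x y).
Proof.
rewrite mxE !vpderiv_graph minkowski_row_mx minkowski_dot; congr (_ + _).
  rewrite !mxE; case: i j => -[|[|]] // hi [[|[|]] // hj];
  by rewrite /= ?mulr0 ?mul0r ?mulr1 ?addr0 ?add0r.
by congr dot; apply: functional_extensionality => k; rewrite mxE.
Qed.

Lemma det_mx2 (A : 'M[R]_2) : \det A = A 0 0 * A 1 1 - A 0 1 * A 1 0.
Proof.
rewrite (expand_det_row _ 0) !big_ord_recl big_ord0 addr0 /cofactor !det_mx11 !mxE.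
rewrite /= !addn0 !addn1 expr0 expr1 mul1r mulN1r mulrN.
by congr (A _ _ * A _ _ - A _ _ * A _ _); apply: val_inj.
Qed.

Local Notation F := component.
Local Notation G11 := (g11 signature F).
Local Notation G12 := (g12 signature F).
Local Notation G22 := (g22 signature F).

Lemma metric00 x y : metric (graph_param f) x y 0 0 = G11 x y.
Proof. by rewrite metric_graph eqxx [RHS]saddE formE. Qed.

Lemma metric01 x y : metric (graph_param f) x y 0 1 = G12 x y.
Proof. by rewrite metric_graph /= add0r [RHS]formE. Qed.

Lemma metric10 x y : metric (graph_param f) x y 1 0 = G12 x y.
Proof. by rewrite metric_graph /= add0r [RHS]formE dotC. Qed.

Lemma metric11 x y : metric (graph_param f) x y 1 1 = G22 x y.
Proof. by rewrite metric_graph eqxx [RHS]saddE formE. Qed.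

Lemma det_metric x y :
  \det (metric (graph_param f) x y) = detg signature F x y :> R.
Proof.
by rewrite det_mx2 metric00 metric01 metric10 metric11 detgE.
Qed.

Lemma area_density_graph x y :
  area_density (graph_param f) x y = sqrt (detg signature F x y).
Proof. by rewrite /area_density det_metric RsqrtE. Qed.

Lemma sum_ord2 (V : nmodType) (E : 'I_2 -> V) : \sum_(i < 2) E i = E 0 + E 1.
Proof.
by rewrite !big_ord_recl big_ord0 addr0; congr (E _ + E _); apply: val_inj.
Qed.

Hypothesis f_spacelike : spacelike (graph_param f).

Lemma spacelike_quadratic x y (a b : R) : (a != 0) || (b != 0) ->
  0 < a * a * G11 x y + 2 * a * b * G12 x y + b * b * G22 x y.
Proof.
move=> ab; pose v : 'rV[R]_2 := \row_i (if i == 0 then a else b).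
have v0 : v != 0.
  apply: contraL ab => /eqP/rowP v0; rewrite negb_or !negbK.
  by have := v0 0; have := v0 1; rewrite !mxE /= => -> ->; rewrite eqxx.
move: (f_spacelike x y v v0) (metric00 x y) (metric01 x y) (metric10 x y)
  (metric11 x y).
move: (metric _ x y) (G11 x y) (G12 x y) (G22 x y).
move=> A p q r vAv E00 E01 E10 E11; move: vAv.
rewrite mxE sum_ord2 !mxE !sum_ord2 !mxE /= E00 E01 E10 E11.
by congr (0 < _); ring.
Qed.

Lemma g11_graph_gt0 x y : 0 < G11 x y.
Proof.
have := spacelike_quadratic x y 1 0; rewrite oner_eq0 => /(_ isT).
by rewrite !mulr1 mulr0 !mul0r mul1r !addr0.
Qed.

Lemma detg_graph_gt0 x y : 0 < detg signature F x y.
Proof.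
have G0 := g11_graph_gt0 x y.
(* On (-g12, g11) the quadratic form equals g11 * det g. *)
have := spacelike_quadratic x y (- G12 x y) (G11 x y).
rewrite (gt_eqF G0) orbT => /(_ isT).
rewrite detgE RminusE !RmultE; move: (G11 x y) (G12 x y) (G22 x y) G0 => p q r p0.
move=> H; rewrite -(pmulr_rgt0 _ p0); move: H.
by congr (0 < _); rewrite RoppE; ring.
Qed.

Hypothesis f_stationary : stationary (graph_param f).

(** In the two Euclidean coordinates the second derivatives of the graph vanish, so zero mean
    curvature annihilates the tangential correction there, and its coefficients with it. Coordinate
    k then reads g^{ij} d_i d_j f_k = 0, which is multiplied by det g. *)
Lemma graph_minimal_system k x y :
  G22 x y * Dx (Dx (F k)) x y - 2 * G12 x y * Dx (Dy (F k)) x y +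
  G11 x y * Dy (Dy (F k)) x y = 0.
Proof.
pose A := metric (graph_param f) x y; pose H := invmx A.
have A_unit : A \in unitmx.
  by rewrite unitmxE unitfE det_metric gt_eqF // detg_graph_gt0.
have AH i j : A i 0 * H 0 j + A i 1 * H 1 j = (i == j)%:R.
  by have := congr1 (fun M : 'M[R]_2 => M i j) (mulmxV A_unit);
    rewrite mxE sum_ord2 [RHS]mxE.
pose S i j l := minkowski (vpderiv i (vpderiv j (graph_param f)) x y)
  (vpderiv l (graph_param f) x y).
have := f_stationary x y => /rowP mc.
have E l : mean_curvature (graph_param f) x y 0 l =
  \sum_(i < 2) \sum_(j < 2) H i j *
    (vpderiv i (vpderiv j (graph_param f)) x y 0 l -
     \sum_(p < 2) \sum_(q < 2) H p q * S i j p * vpderiv q (graph_param f) x y 0 l).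
  rewrite /mean_curvature summxE; apply: eq_bigr => i _; rewrite summxE.
  apply: eq_bigr => j _; rewrite mxE; congr (_ * _).
  rewrite /second_fundamental_form /normal_part mxE; congr (_ + _).
  rewrite mxE summxE; congr (- _); apply: eq_bigr => p _; rewrite summxE.
  by apply: eq_bigr => q _; rewrite mxE.
pose P q := pderiv q (F k) x y; pose Q i j := pderiv i (pderiv j (F k)) x y.
have X1 q l : vpderiv q (graph_param f) x y 0 (lshift m l) = (l == q)%:R.
  by rewrite vpderiv_graph row_mxEl mxE.
have X1k q : vpderiv q (graph_param f) x y 0 (rshift 2 k) = P q.
  by rewrite vpderiv_graph row_mxEr mxE.
have X2 i j l : vpderiv i (vpderiv j (graph_param f)) x y 0 (lshift m l) = 0.
  by rewrite vpderiv2_graph row_mxEl mxE.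
have X2k i j : vpderiv i (vpderiv j (graph_param f)) x y 0 (rshift 2 k) = Q i j.
  by rewrite vpderiv2_graph row_mxEr mxE.
have := mc (lshift m 0); have := mc (lshift m 1); have := mc (rshift 2 k).
rewrite !E ![(0 : 'rV[R]_ _) 0 _]mxE !sum_ord2 !X1 !X1k !X2 !X2k !eqxx.
rewrite (_ : (1 == 0 :> 'I_2)%:R = 0) //.
rewrite (_ : true%:R = 1) //.
move: (S 0 0 0) (S 0 0 1) (S 0 1 0) (S 0 1 1) (S 1 0 0) (S 1 0 1) (S 1 1 0) (S 1 1 1).
move=> s1 s2 s3 s4 s5 s6 s7 s8 Ek E1 E0.
have T0 : H 0 0 * Q 0 0 + H 0 1 * Q 0 1 + H 1 0 * Q 1 0 + H 1 1 * Q 1 1 = 0.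
  have := f_equal2 (fun a b => a - b) Ek
    (f_equal2 (fun a b => a + b) (congr1 (fun a => a * P 0) E0)
       (congr1 (fun a => a * P 1) E1)).
  move: (H 0 0) (H 0 1) (H 1 0) (H 1 1) (P 0) (P 1) (Q 0 0) (Q 0 1) (Q 1 0) (Q 1 1).
  by move=> h1 h2 h3 h4 p1 p2 q1 q2 q3 q4 C; apply: etrans (etrans C _); ring.
have A01 : A 0 1 = A 1 0 by rewrite /A metric01 metric10.
have [A00 A11] : A 0 0 = G11 x y /\ A 1 1 = G22 x y by rewrite /A metric00 metric11.
have Q10 : Q 1 0 = Q 0 1.
  by have := congr1 (fun g : sfun => g x y) (DyDx (F k)).
have A10 : A 1 0 = G12 x y by rewrite /A metric10.
rewrite -A00 -A11 -A10.
rewrite -[Dx (Dx _) x y]/(Q 0 0) -[Dx (Dy _) x y]/(Q 0 1) -[Dy (Dy _) x y]/(Q 1 1).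
have B00 : A 0 0 * H 0 0 + A 0 1 * H 1 0 = 1 by rewrite AH.
have B01 : A 0 0 * H 0 1 + A 0 1 * H 1 1 = 0 by rewrite AH.
have B10 : A 1 0 * H 0 0 + A 1 1 * H 1 0 = 0 by rewrite AH.
have B11 : A 1 0 * H 0 1 + A 1 1 * H 1 1 = 1 by rewrite AH.
move: T0 B00 B01 B10 B11; rewrite A01 Q10.
move: (A 0 0) (A 1 0) (A 1 1) (H 0 0) (H 0 1) (H 1 0) (H 1 1) (Q 0 0) (Q 0 1) (Q 1 1).
move=> a b c h1 h2 h3 h4 q1 q2 q3 T0 B00 B01 B10 B11.
have D1 : (a * c - b * b) * h1 = c.
  by rewrite -[RHS]mulr1 -B00 -[RHS]subr0 -(mulr0 b) -B10; ring.
have D2 : (a * c - b * b) * h2 = - b.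
  by rewrite -[RHS]mulr1 -B11 -[RHS]addr0 -(mulr0 c) -B01; ring.
have D3 : (a * c - b * b) * h3 = - b.
  by rewrite -[RHS]mulr1 -B00 -[RHS]addr0 -(mulr0 a) -B10; ring.
have D4 : (a * c - b * b) * h4 = a.
  by rewrite -[RHS]mulr1 -B11 -[RHS]subr0 -(mulr0 b) -B01; ring.
rewrite -(mulr0 (a * c - b * b)) -T0 -[X in X * q1]D1 -[X in _ + X * q3]D4.
rewrite (_ : 2 * b * q2 = - ((a * c - b * b) * h2 + (a * c - b * b) * h3) * q2).
  by ring.
by rewrite D2 D3; ring.
Qed.

Lemma time_index_subproof : (m.-1 < m)%N.
Proof. by rewrite prednK. Qed.

Definition time_index : 'I_m := Ordinal time_index_subproof.

Lemma signature_time : signature time_index = -1.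
Proof. by rewrite /signature /= prednK // eqxx expr1. Qed.

Lemma signature_space k : k != time_index -> signature k = 1.
Proof.
move=> kt; rewrite /signature (_ : k.+1 == m = false) //.
by apply: contraNF kt => /eqP km; apply/eqP/val_inj; apply: (congr1 predn km).
Qed.

(** The second alternative records W = 1, which is what contradicts a strictly area-increasing
    projection. *)
Lemma graph_alternative :
  (forall x y, area_density (graph_param f) x y <= 1) ->
  (forall k, exists p q, forall x y, F k x y = p * x + q * y + F k 0 0) \/
  [/\ forall x y, area_density (graph_param f) x y = 1,
      forall k x y, Dx (Dx (F k)) x y + Dy (Dy (F k)) x y = 0 &
      exists c, [/\ c time_index = 1, dot signature c c = 0 &
        forall k x y, F k x y =
          c k * F time_index x y + (F k 0 0 - c k * F time_index 0 0)]].
Proof.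
move=> W_le1; pose W x y := sqrt (detg signature F x y).
have {}W_le1 x y : Rle (W x y) 1 by apply/RleP; have := W_le1 x y; rewrite area_density_graph.
have a0 x y : Rlt 0 (G11 x y) by apply/RltP; apply: g11_graph_gt0.
have w0 x y : Rlt 0 (detg signature F x y) by apply/RltP; apply: detg_graph_gt0.
have [U [V [UV1 H]]] := minimal_isothermal signature F a0 w0 graph_minimal_system.
case: (Rlt_le_dec 0 (Rplus (Rmult U U) (Rmult V V))) => q0.
  left; apply: (entire_affine signature time_index signature_time signature_space
    (const_frame U V UV1) F W U V) => //.
  - by move=> g x y; apply: bel1E.
  - by move=> g x y; apply: bel2E.
  - by move=> k x y; have [h _ _ _] := H x y; apply: h.
  - by move=> x y; have [_ h1 h2 h3] := H x y; split.
have {q0} [U0 V0] : U = IZR 0 /\ V = IZR 0 by split; nra.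
move: H; rewrite U0 V0 => H.
have d1 g : bel1 (sconst 0) (sconst 0) g = Dx g by rewrite -std_d1.
have d2 g : bel2 (sconst 0) (sconst 0) g = Dy g by rewrite -std_d2.
have harm k x y : Dx (Dx (F k)) x y + Dy (Dy (F k)) x y = 0.
  by have [h _ _ _] := H x y; have := h k; rewrite !d1 !d2.
have conf x y : let A k := Dx (F k) x y in let B k := Dy (F k) x y in
    [/\ Rplus (dot signature A A) 1 = W x y, Rplus (dot signature B B) 1 = W x y &
      dot signature A B = IZR 0].
  have [_ h1 h2 h3] := H x y; move: h1 h2 h3; cbv zeta.
  rewrite (_ : (fun k => bel1 _ _ (F k) x y) = fun k => Dx (F k) x y); last first.
    by apply: functional_extensionality => k; rewrite d1.
  rewrite (_ : (fun k => bel2 _ _ (F k) x y) = fun k => Dy (F k) x y); last first.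
    by apply: functional_extensionality => k; rewrite d2.
  by rewrite -/(W x y) => h1 h2 h3; split; lra.
have [aff|ratio] := null_entire signature time_index signature_time signature_space
  F W harm conf W_le1; first by left.
right; split=> // x y; rewrite area_density_graph.
exact: (null_area signature time_index signature_time signature_space F W conf W_le1).
Qed.

Lemma affine_linear_graph :
  (forall k, exists p q, forall x y, F k x y = p * x + q * y + F k 0 0) ->
  affine_linear f.
Proof.
case/functional_choice => p /functional_choice [q pq].
exists (\row_k p k), (\row_k q k), (f 0 0) => x y; apply/rowP => k.
by rewrite !mxE [LHS](pq k x y) (mulrC x) (mulrC y).
Qed.

Lemma affine_plane_graph : affine_linear f -> affine_plane (graph f).
Proof.
case=> a [b [c fE]].
exists (row_mx 0 c), (row_mx (delta_mx 0 0) a), (row_mx (delta_mx 0 1) b).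
have gE x y : graph_param f x y = row_mx 0 c + x *: row_mx (delta_mx 0 0) a +
    y *: row_mx (delta_mx 0 1) b.
  rewrite !scale_row_mx !add_row_mx /graph_param fE add0r; congr row_mx.
    apply/rowP => i; rewrite !mxE /=; case: i => -[|[|]] //= _;
    by rewrite ?mulr0 ?mulr1 ?addr0 ?add0r.
  by rewrite addrC addrA.
split; last first.
  move=> z; split=> [[x [y ->]]|[x [y ->]]]; first by exists x, y; apply: gE.
  by exists x, y; rewrite gE.
(* The Euclidean halves of the two direction vectors are the standard basis, which already makes
   them independent. *)
apply: inj_row_free => v; rewrite -[v]hsubmxK mul_row_col !mul_mx_row add_row_mx.
move=> /(congr1 lsubmx); rewrite row_mxKl linear0 => H.
have h0 : lsubmx v 0 0 = 0.
  have := congr1 (fun w : 'rV[R]_2 => w 0 0) H.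
  by rewrite !mxE !big_ord1 !mxE /= mulr1 mulr0 addr0.
have h1 : rsubmx v 0 0 = 0.
  have := congr1 (fun w : 'rV[R]_2 => w 0 1) H.
  by rewrite !mxE !big_ord1 !mxE /= mulr1 mulr0 add0r.
have hl : lsubmx v = 0 by apply/rowP => i; rewrite ord1 [LHS]h0 [RHS]mxE.
have hr : rsubmx v = 0 by apply/rowP => i; rewrite ord1 [LHS]h1 [RHS]mxE.
by rewrite hl hr row_mx0.
Qed.

End GraphGeometry.

Theorem theorem5p1 (m : nat) (m_ge1 : (1 <= m)%N) (f : R -> R -> 'rV[R]_m)
    (f_smooth : smooth f)
    (f_spacelike : spacelike (graph_param f))
    (f_stationary : stationary (graph_param f)) :
  (proj_area_increasing f ->
     affine_linear f \/
     exists (h : R -> R -> R) (y0 y1 : 'rV[R]_m),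
       harmonic h /\ ~ affine_linear (h : R -> R -> R^o) /\
       y0 <> 0 /\ lightlike y0 /\
       forall x1 x2, f x1 x2 = h x1 x2 *: y0 + y1) /\
  (proj_strictly_area_increasing f ->
     affine_linear f /\ affine_plane (graph f)).
Proof.
have alt := graph_alternative m f m_ge1 f_smooth f_spacelike f_stationary.
have aff := affine_linear_graph m f f_smooth.
split=> [W_le1|W_lt1]; last first.
  have {}alt := alt (fun x y => ltW (W_lt1 x y)).
  have {}aff : affine_linear f.
    case: alt => [|[W1 _ _]]; first exact: aff.
    by have := W_lt1 0 0; rewrite W1 ltxx.
  by split=> //; apply: affine_plane_graph.
case: (alt W_le1) => [|[_ harm [c [ct cc fE]]]]; first by left; apply: aff.
(* Proportional components may still be affine; that case goes to the first disjunct, so that h is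
   nonlinear in the second. *)
case: (classic (affine_linear f)) => [|naff]; [by left | right].
(* h is the time component of f, and the vector of ratios is nonzero because its time coordinate is
   1. *)
pose t := time_index m m_ge1; pose h := component m f f_smooth t.
pose y1 : 'rV[R]_m := \row_k (f 0 0 0 k - c k * h 0 0).
have fh x y : f x y = h x y *: (\row_k c k) + y1.
  by apply/rowP => k; rewrite !mxE [LHS](fE k x y) (mulrC (c k)).
exists h, (\row_k c k), y1; split; last split; last split; last split=> //.
- split=> x y; first exact: f_smooth.
  by rewrite sum_ord2; apply: harm.
- case=> p [q [r hE]]; apply: naff.
  exists (p *: \row_k c k), (q *: \row_k c k), (r *: (\row_k c k) + y1) => x y.
  by rewrite fh hE !scalerDl !scalerA -!addrA.
- move=> /rowP/(_ t); rewrite !mxE ct => /eqP; rewrite oner_eq0 //.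
- rewrite /lightlike minkowski_dot -[RHS]cc; congr dot;
  by apply: functional_extensionality => k; rewrite mxE.
Qed.
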